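(* Each of the quantities $E\in\{\mathcal{T}_{min}^{(4)},\mathcal{T}_{GM}^{(4)},\bar{\mathcal{T}}_{min}^{(4)},\bar{\mathcal{T}}_{GM}^{(4)}\}$ on four-qubit states satisfies: (i) for every four-qubit state $\rho$, $E(\rho)>0$ if and only if $\rho$ is not biseparable; (ii) $E$ is invariant under local unitary transformations; (iv) $E$ is convex.
   Context: States of four qubits $A_1,A_2,A_3,A_4$ are density operators on $(\mathbb{C}^2)^{\otimes 4}$; pure states are unit vectors. (The labels (i), (ii), (iv) are those of the paper's list of conditions for a genuine multipartite entanglement measure.) Fully entangled fraction: for a two-qubit state $\rho$, $f(\rho)=\max_{|e\rangle}\langle e|\rho|e\rangle$, the maximum being over all maximally entangled unit vectors $|e\rangle\in\mathbb{C}^2\otimes\mathbb{C}^2$ (both reduced states equal to $I/2$). For $N\in\{3,4\}$, an $N$-qubit state $\rho$, distinct systems $i,j$, and $K=\{k_1,\dots,k_{N-2}\}$ the set of the other systems, define $$f_{ij}^{(N)}(\rho)=\max_{U_K}\sum_{J\in\{0,1\}^{N-2}}\langle J|U_K\rho_KU_K^\dagger|J\rangle\, f\!\left(\rho_{ij}^{U_K,J}\right),$$ where $U_K=U_{k_1}\otimes\cdots\otimes U_{k_{N-2}}$ ranges over products of one-qubit unitaries, $\rho_K$ is the reduced state of $\rho$ on $K$, and $\rho_{ij}^{U_K,J}$ is the normalized state of $i,j$ after each $k_l\in K$ is measured in the basis $\{U_{k_l}^\dagger|0\rangle,U_{k_l}^\dagger|1\rangle\}$ with joint outcome $J$. Also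 define, for four-qubit $\rho$, $$\bar f_{ij}^{(4)}(\rho)=\max_{k_l\in K}\left(\max_{U_{k_l}}\sum_{t=0}^1\langle t|U_{k_l}\rho_{k_l}U_{k_l}^\dagger|t\rangle\, f_{ij}^{(3)}\!\left(\rho^{U_{k_l},t}\right)\right),$$ where $U_{k_l}$ ranges over one-qubit unitaries, $\rho_{k_l}$ is the reduced state of $k_l$, and $\rho^{U_{k_l},t}$ is the normalized state of the remaining three qubits after measuring $k_l$ in the basis $\{U_{k_l}^\dagger|0\rangle,U_{k_l}^\dagger|1\rangle\}$ with outcome $t$. Zero-probability terms count as $0$. Put $$F_{ij}^{(4)}=\frac{2f_{ij}^{(4)}+1}{3},\qquad \bar F_{ij}^{(4)}=\frac{2\bar f_{ij}^{(4)}+1}{3}.$$ On four-qubit pure states let $\mathcal{T}_{ij}^{(4)}=3F_{ij}^{(4)}-2$ and $$\mathcal{T}_{min}^{(4)}=\min_{i<j}\mathcal{T}_{ij}^{(4)},\qquad \mathcal{T}_{GM}^{(4)}=\Big(\prod_{i<j}\mathcal{T}_{ij}^{(4)}\Big)^{1/6},$$ with $i<j$ ranging over the $\binom42=6$ pairs of systems; $\bar{\mathcal{T}}_{min}^{(4)}$ and $\bar{\mathcal{T}}_{GM}^{(4)}$ are defined in the same way with $\bar F_{ij}^{(4)}$ in place of $F_{ij}^{(4)}$. On mixed states all four are defined by the convex roof $E(\rho)=\min\sum_l p_lE(|\psi_l\rangle)$, the minimum being over all decompositions $\rho=\sum_l p_l|\psi_l\rangle\langle\psi_l|$ into pure states.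 Biseparable: a pure state is biseparable if it is a product vector with respect to some bipartition of the set of parties into two nonempty subsets; a mixed state is biseparable if it is a convex combination of biseparable pure states (possibly with respect to different bipartitions). *)

(* Defs.v *)
From mathcomp Require Import all_boot all_order all_algebra.
From mathcomp Require Import complex.
From mathcomp Require Import boolp classical_sets reals exp.

Set Implicit Arguments.
Unset Strict Implicit.
Unset Printing Implicit Defensive.

Import Order.TTheory GRing.Theory Num.Theory.
Local Open Scope ring_scope.
Local Open Scope complex_scope.
Local Open Scope sesquilinear_scope.

(* A register is a finite type T of parties, each party holding one qubit.
   Its computational basis consists of the bit strings [ket T]; vectors and
   operators are columns and square matrices whose indices are identified with
   bit strings by kidx / kval.  The parties in A : {set T} form the
   register [sub A].

   Each max (resp. min) over an infinite set is written sup (resp. inf); all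
   of these extrema are attained, by compactness. *)

Definition ket (T : finType) : finType := {ffun T -> 'I_2}.
Definition dimq (T : finType) : nat := #|ket T|.
Definition kidx (T : finType) (a : ket T) : 'I_(dimq T) := enum_rank a.
Definition kval (T : finType) (a : 'I_(dimq T)) : ket T := enum_val a.
Definition sub (T : finType) (A : {set T}) : finType := {x : T | x \in A}.
Definition restr (T : finType) (A : {set T}) (a : ket T) : ket (sub A) :=
  [ffun x => a (val x)].

Definition proj_of (R : realType) (n : nat) (psi : 'cV[R[i]]_n) : 'M[R[i]]_n :=
  psi *m psi ^t*.

Definition unit_vector (R : realType) (n : nat) (psi : 'cV[R[i]]_n) : Prop :=
  (psi ^t* *m psi) 0 0 = 1.

(* In the order of R[i], 0 <= z means that z is real and nonnegative, so that
   the first conjunct also makes rho Hermitian. *)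
Definition density (R : realType) (n : nat) (rho : 'M[R[i]]_n) : Prop :=
  (forall v : 'cV[R[i]]_n, 0 <= (v ^t* *m rho *m v) 0 0) /\ \tr rho = 1.

Definition tens_op (R : realType) (T : finType) (U : T -> 'M[R[i]]_2) :
    'M[R[i]]_(dimq T) :=
  \matrix_(a, b) \prod_(t : T) U t (kval a t) (kval b t).

Definition reduced (R : realType) (T : finType) (A : {set T})
    (rho : 'M[R[i]]_(dimq T)) : 'M[R[i]]_(dimq (sub A)) :=
  \matrix_(a, b) \sum_(x : ket T | restr A x == kval a)
    \sum_(y : ket T | (restr A y == kval b) &&
                      (restr (~: A)%SET y == restr (~: A)%SET x))
      rho (kidx x) (kidx y).

(* The operator <J|U_K (x) I from the register T to the unmeasured parties. *)
Definition bra_op (R : realType) (T : finType) (K : {set T})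
    (U : sub K -> 'M[R[i]]_2) (J : ket (sub K)) :
    'M[R[i]]_(dimq (sub (~: K)%SET), dimq T) :=
  \matrix_(c, x)
    if restr (~: K)%SET (kval x) == kval c
    then tens_op U (kidx J) (kidx (restr K (kval x))) else 0.

Definition prob (R : realType) (T : finType) (K : {set T})
    (U : sub K -> 'M[R[i]]_2) (J : ket (sub K)) (rho : 'M[R[i]]_(dimq T)) : R :=
  complex.Re ((tens_op U *m reduced K rho *m (tens_op U) ^t*)
                (kidx J) (kidx J)).

(* For an outcome of probability 0 this is the zero matrix; the term in which
   it occurs below is then multiplied by 0. *)
Definition post_state (R : realType) (T : finType) (K : {set T})
    (U : sub K -> 'M[R[i]]_2) (J : ket (sub K)) (rho : 'M[R[i]]_(dimq T)) :
    'M[R[i]]_(dimq (sub (~: K)%SET)) :=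
  ((prob U J rho)^-1)%:C *: (bra_op U J *m rho *m (bra_op U J) ^t*).

Definition max_entangled (R : realType) (T : finType)
    (e : 'cV[R[i]]_(dimq T)) : Prop :=
  unit_vector e /\
  forall t : T, reduced [set t]%SET (proj_of e) = (2^-1)%:M.

(* Used for two-party registers T only. *)
Definition fef (R : realType) (T : finType) (rho : 'M[R[i]]_(dimq T)) : R :=
  sup [set v | exists2 e : 'cV[R[i]]_(dimq T),
         max_entangled e & v = complex.Re ((e ^t* *m rho *m e) 0 0)]%classic.

(* For a two-element P = {i, j} and #|T| = N, this is f_ij^(N). *)
Definition fpair (R : realType) (T : finType) (P : {set T})
    (rho : 'M[R[i]]_(dimq T)) : R :=
  sup [set v | exists2 U : sub (~: P)%SET -> 'M[R[i]]_2,
         (forall k, U k \is unitarymx) &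
         v = \sum_(J : ket (sub (~: P)%SET))
               prob U J rho * fef (post_state U J rho)]%classic.

Definition f4 (R : realType) (i j : 'I_4) (rho : 'M[R[i]]_(dimq 'I_4)) : R :=
  fpair [set i; j]%SET rho.

Definition fbar4_at (R : realType) (i j k : 'I_4)
    (rho : 'M[R[i]]_(dimq 'I_4)) : R :=
  let Uk (U : 'M[R[i]]_2) := fun _ : sub [set k]%SET => U in
  let outcome (t : 'I_2) : ket (sub [set k]%SET) := [ffun=> t] in
  let ij := [set x : sub (~: [set k])%SET | val x \in [set i; j]%SET]%SET in
  sup [set v | exists2 U : 'M[R[i]]_2, U \is unitarymx &
         v = \sum_(t < 2) prob (Uk U) (outcome t) rho *
                          fpair ij (post_state (Uk U) (outcome t) rho)]%classic.

Definition fbar4 (R : realType) (i j : 'I_4) (rho : 'M[R[i]]_(dimq 'I_4)) : R :=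
  sup [set v | exists2 k : 'I_4, k \notin [set i; j]%SET
                               & v = fbar4_at i j k rho]%classic.

Definition F4 (R : realType) (i j : 'I_4) (rho : 'M[R[i]]_(dimq 'I_4)) : R :=
  (2 * f4 i j rho + 1) / 3.
Definition Fbar4 (R : realType) (i j : 'I_4) (rho : 'M[R[i]]_(dimq 'I_4)) : R :=
  (2 * fbar4 i j rho + 1) / 3.

Definition T4 (R : realType) (i j : 'I_4) (psi : 'cV[R[i]]_(dimq 'I_4)) : R :=
  3 * F4 i j (proj_of psi) - 2.
Definition Tbar4 (R : realType) (i j : 'I_4) (psi : 'cV[R[i]]_(dimq 'I_4)) : R :=
  3 * Fbar4 i j (proj_of psi) - 2.

(* The seed of the iterated minimum is itself one of the six values. *)
Definition min_pairs (R : realType) (t : 'I_4 -> 'I_4 -> R) : R :=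
  \big[Num.min/t ord0 ord_max]_(ij : 'I_4 * 'I_4 | (ij.1 < ij.2)%N) t ij.1 ij.2.
Definition gm_pairs (R : realType) (t : 'I_4 -> 'I_4 -> R) : R :=
  powR (\prod_(ij : 'I_4 * 'I_4 | (ij.1 < ij.2)%N) t ij.1 ij.2) (6^-1).

Definition decomposition (R : realType) (n m : nat) (p : 'I_m -> R)
    (psi : 'I_m -> 'cV[R[i]]_n) (rho : 'M[R[i]]_n) : Prop :=
  [/\ forall l, 0 <= p l, \sum_(l < m) p l = 1, forall l, unit_vector (psi l)
    & rho = \sum_(l < m) (p l)%:C *: proj_of (psi l)].

(* On a pure state all decompositions consist of that state, up to phases, so
   the roof extends E. *)
Definition convex_roof (R : realType) (n : nat) (E : 'cV[R[i]]_n -> R)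
    (rho : 'M[R[i]]_n) : R :=
  inf [set v | exists m (p : 'I_m -> R) (psi : 'I_m -> 'cV[R[i]]_n),
         decomposition p psi rho /\ v = \sum_(l < m) p l * E (psi l)]%classic.

Definition Tmin4 (R : realType) : 'M[R[i]]_(dimq 'I_4) -> R :=
  convex_roof (fun psi => min_pairs (fun i j => T4 i j psi)).
Definition TGM4 (R : realType) : 'M[R[i]]_(dimq 'I_4) -> R :=
  convex_roof (fun psi => gm_pairs (fun i j => T4 i j psi)).
Definition Tbarmin4 (R : realType) : 'M[R[i]]_(dimq 'I_4) -> R :=
  convex_roof (fun psi => min_pairs (fun i j => Tbar4 i j psi)).
Definition TbarGM4 (R : realType) : 'M[R[i]]_(dimq 'I_4) -> R :=
  convex_roof (fun psi => gm_pairs (fun i j => Tbar4 i j psi)).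

Definition biseparable_pure (R : realType) (T : finType)
    (psi : 'cV[R[i]]_(dimq T)) : Prop :=
  exists A : {set T}, [/\ A != finset.set0, A != [set: T]%SET &
    exists (phi : 'cV[R[i]]_(dimq (sub A)))
           (chi : 'cV[R[i]]_(dimq (sub (~: A)%SET))),
      forall x : ket T, psi (kidx x) 0 =
        phi (kidx (restr A x)) 0 *
        chi (kidx (restr (~: A)%SET x)) 0].

Definition biseparable (R : realType) (T : finType)
    (rho : 'M[R[i]]_(dimq T)) : Prop :=
  exists m (p : 'I_m -> R) (psi : 'I_m -> 'cV[R[i]]_(dimq T)),
    decomposition p psi rho /\ forall l, biseparable_pure (psi l).

(* Main.v *)
Require Import Defs.
From mathcomp Require Import all_boot all_order all_algebra.
From mathcomp Require Import complex.
From mathcomp Require Import boolp classical_sets reals exp.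
From mathcomp Require Import topology normedtype ring lra.

(* A two-qubit vector with coefficient matrix m has fully entangled fraction
   |m|^2 / 2 + |det m|.  Hence on unit vectors each of the twelve quantities T_ij
   is a supremum of sums of 2 |det m|, where m runs over the contractions of
   psi with product vectors on the other two parties.  It vanishes iff all
   these determinants vanish, and this forces psi to be biseparable: a linear
   pencil of matrices of rank at most 1 has a common row or column space, and
   applying this to the two contracted parties in turn factors psi across one
   of the four bipartitions separating i from j.

   The determinants at nine pairs of probe vectors already detect vanishing,
   so all four pure-state quantities dominate one polynomial [witness] with
   the biseparable vectors as its zeros.  By Caratheodory's argument the convex
   roof of [witness] only needs decompositions of bounded length, which form a
   compact set, so it is positive on states that are not biseparable. *)

Set Implicit Arguments.
Unset Strict Implicit.
Unset Printing Implicit Defensive.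

Import Order.TTheory GRing.Theory Num.Theory numFieldNormedType.Exports.
Local Open Scope ring_scope.
Local Open Scope complex_scope.
Local Open Scope sesquilinear_scope.

(** The obstacle is that the pure-state quantities are suprema over measurement bases, nested ones
    in the barred case, so their continuity cannot be read off and compactness is not applied to
    them directly. A one-sided comparison is enough: strict positivity of the roof of a continuous
    function passes to the roof of anything above it. Hence only lower bounds at fixed measurement
    vectors are extracted from the suprema, while the upper bounds must hold for every choice of
    bases.

    The norm term in the fully entangled fraction explains why only determinants survive. The
    squared norms of the unnormalized outcomes always add up to 1, so their halves contribute
    exactly 1/2 whatever the bases, and the map from f to 2f - 1 removes this. Everything is
    quadratic in the vector, so probabilities cancel against normalizations. Measuring one party
    first and adapting the next basis still contracts each outcome with a product vector, so the
    barred quantities are controlled by the same determinants. *)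

Local Notation nc := ComplexField.Normc.normc.

(** * Registers and measurement operators *)

Lemma big_kidx (R : Type) (idx : R) (op : Monoid.com_law idx) (T : finType)
    (F : 'I_(dimq T) -> R) :
  \big[op/idx]_a F a = \big[op/idx]_(x : ket T) F (kidx x).
Proof. by rewrite (reindex (@kidx T)) //; exact: onW_bij (enum_rank_bij _). Qed.

Lemma kidxK (T : finType) : cancel (@kidx T) (@kval T).
Proof. exact: enum_rankK. Qed.

Lemma kvalK (T : finType) : cancel (@kval T) (@kidx T).
Proof. exact: enum_valK. Qed.

Lemma kidx_eq (T : finType) (x y : ket T) : (kidx x == kidx y) = (x == y).
Proof. exact: (inj_eq (can_inj (@kidxK T))). Qed.

Lemma ket_matrixP (C : Type) (S T : finType) (A B : 'M[C]_(dimq S, dimq T)) :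
  (forall x y, A (kidx x) (kidx y) = B (kidx x) (kidx y)) -> A = B.
Proof.
by move=> h; apply/matrixP => a b; rewrite -(kvalK a) -(kvalK b) h.
Qed.

Lemma sum_fiber (V : nmodType) (I J : finType) (f : J -> I)
    (F : I -> J -> V) :
  \sum_i \sum_(j | f j == i) F i j = \sum_j F (f j) j.
Proof.
rewrite (exchange_big_dep predT) //=; apply: eq_bigr => j _.
by rewrite (eq_bigl (pred1 (f j))) ?big_pred1_eq // => i; rewrite /= eq_sym.
Qed.

Section Registers.
Variables (R : realType) (T : finType).
Implicit Types (K A : {set T}) (x y z : ket T).
Local Notation C := R[i].

Lemma restr_inj A x y :
  restr A x = restr A y -> restr (~: A)%SET x = restr (~: A)%SET y -> x = y.
Proof.
move=> /ffunP h1 /ffunP h2; apply/ffunP => t.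
have [tA|tA] := boolP (t \in A); first by have := h1 (exist _ t tA); rewrite !ffunE.
have tA' : t \in (~: A)%SET by rewrite inE.
by have := h2 (exist _ t tA'); rewrite !ffunE.
Qed.

(** The final [ord0] is never reached, since every party lies in [A] or in its complement. *)
Definition glue A (b : ket (sub A)) (c : ket (sub (~: A)%SET)) : ket T :=
  [ffun t => if insub t is Some s then b s
             else if insub t is Some s then c s else ord0].

Lemma glueL A b c (s : sub A) : @glue A b c (val s) = b s.
Proof. by rewrite ffunE valK. Qed.

Lemma glueR A b c (s : sub (~: A)%SET) : @glue A b c (val s) = c s.
Proof.
rewrite ffunE insubF ?valK //.
by apply/negbTE; have := valP s; rewrite inE.
Qed.

Lemma restr_glueL A b c : restr A (glue b c) = b.
Proof. by apply/ffunP => s; rewrite ffunE glueL. Qed.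

Lemma restr_glueR A b c : restr (~: A)%SET (glue b c) = c.
Proof. by apply/ffunP => s; rewrite ffunE glueR. Qed.

Lemma glue_restr A x : glue (restr A x) (restr (~: A)%SET x) = x.
Proof. by apply: (@restr_inj A); rewrite ?restr_glueL ?restr_glueR. Qed.

Lemma sum_glue (V : nmodType) A (F : ket T -> V) :
  \sum_x F x = \sum_b \sum_c F (@glue A b c).
Proof.
rewrite pair_big /= (reindex (fun p => @glue A p.1 p.2)) //=.
exists (fun x => (restr A x, restr (~: A)%SET x)) => [[b c] _|x _] /=.
  by rewrite restr_glueL restr_glueR.
exact: glue_restr.
Qed.

Lemma prod_glue A (F : T -> C) :
  \prod_t F t =
  (\prod_(s : sub A) F (val s)) * \prod_(s : sub (~: A)%SET) F (val s).
Proof.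
rewrite (bigID (mem A)) /=; congr (_ * _); first exact: (big_sub (mem A)).
rewrite -(big_sub (mem (~: A)%SET)) /=; apply: eq_bigl => t.
by rewrite [RHS]inE.
Qed.

Implicit Types (U V : T -> 'M[C]_2).

Lemma tens_opE U x y : tens_op U (kidx x) (kidx y) = \prod_t U t (x t) (y t).
Proof. by rewrite mxE !kidxK. Qed.

Lemma tens_op_mul U V : tens_op U *m tens_op V = tens_op (fun t => U t *m V t).
Proof.
apply: ket_matrixP => x y; rewrite tens_opE mxE big_kidx.
under [RHS]eq_bigr do rewrite mxE.
rewrite bigA_distr_bigA; apply: eq_bigr => z _.
by rewrite !tens_opE big_split.
Qed.

Lemma tens_op_adj U : (tens_op U)^t* = tens_op (fun t => (U t)^t*).
Proof.
apply: ket_matrixP => x y; rewrite tens_opE !mxE !kidxK rmorph_prod.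
by apply: eq_bigr => t _; rewrite !mxE.
Qed.

Lemma tens_op1 : tens_op (fun _ : T => 1%:M) = 1%:M :> 'M[C]_(dimq T).
Proof.
apply: ket_matrixP => x y; rewrite tens_opE mxE kidx_eq.
have [->|xy] := eqVneq x y.
  by rewrite big1 // => t _; rewrite mxE eqxx.
have [t xyt] : exists t, x t != y t.
  apply/existsP; apply: contraNT xy; rewrite negb_exists => /forallP h.
  by apply/eqP/ffunP => t; apply/eqP; have := h t; rewrite negbK.
by rewrite (bigD1 t) //= mxE (negbTE xyt) mul0r.
Qed.

Lemma tens_op_unitary U : (forall t, U t \is unitarymx) ->
  tens_op U \is unitarymx.
Proof.
move=> hU; apply/unitarymxP; rewrite tens_op_adj tens_op_mul -tens_op1.
by congr tens_op; apply: funext => t; apply/unitarymxP.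
Qed.

End Registers.

Section Measurement.
Variables (R : realType) (T : finType) (K : {set T}).
Implicit Types (x y z : ket T) (U : sub K -> 'M[R[i]]_2) (J : ket (sub K)).
Local Notation C := R[i].

Lemma bra_opE U J c x : bra_op U J (kidx c) (kidx x) =
  if restr (~: K)%SET x == c then tens_op U (kidx J) (kidx (restr K x)) else 0.
Proof. by rewrite mxE !kidxK. Qed.

Lemma bra_op_apply U J (phi : 'cV[C]_(dimq T)) c :
  (bra_op U J *m phi) (kidx c) 0 =
  \sum_(x : ket T | restr (~: K)%SET x == c)
     (\prod_s U s (J s) (x (val s))) * phi (kidx x) 0.
Proof.
rewrite mxE big_kidx [RHS]big_mkcond; apply: eq_bigr => x _.
rewrite bra_opE; case: ifP => _; rewrite ?mul0r // tens_opE.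
by congr (_ * _); apply: eq_bigr => s _; rewrite ffunE.
Qed.

(** Summing over [J] produces the adjoint of the local unitary times itself on [K], and the other
    parties are untouched. *)
Lemma bra_op_complete U : (forall k, U k \is unitarymx) ->
  \sum_J (bra_op U J)^t* *m bra_op U J = 1%:M :> 'M[C]_(dimq T).
Proof.
move=> hU; apply: ket_matrixP => x y; rewrite summxE mxE kidx_eq.
transitivity (\sum_J if restr (~: K)%SET x == restr (~: K)%SET y then
   ((tens_op U)^t* (kidx (restr K x)) (kidx J) *
     tens_op U (kidx J) (kidx (restr K y))) else 0).
  apply: eq_bigr => J _; rewrite mxE big_kidx.
  rewrite (bigD1 (restr (~: K)%SET y)) //=.
  rewrite big1 => [|c /negbTE hc]; last first.
    by rewrite [X in _ * X]bra_opE eq_sym hc mulr0.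
  rewrite addr0 bra_opE eqxx 2!mxE bra_opE.
  by case: ifP => _; rewrite ?conjC0 ?mul0r // !mxE.
have [h|h] := eqVneq (restr (~: K)%SET x) (restr (~: K)%SET y).
  transitivity (((tens_op U)^t* *m tens_op U)
      (kidx (restr K x)) (kidx (restr K y))); first by rewrite mxE big_kidx.
  have := tens_op_unitary hU; rewrite -trmxC_unitary => /unitarymxP.
  rewrite trmxCK => ->; rewrite mxE kidx_eq; congr ((_ : bool)%:R).
  by apply/eqP/eqP => [h'|->] //; apply: restr_inj h' h.
rewrite big1 //; case: eqP => // xy.
by rewrite xy eqxx in h.
Qed.

(** The factors of [V] on [K] rotate the measured basis, the others act after the measurement. This
    is the source of local unitary invariance for the pure-state quantities. *)
Lemma bra_op_tens U J (V : T -> 'M[C]_2) :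
  bra_op U J *m tens_op V =
  tens_op (fun s : sub (~: K)%SET => V (val s)) *m
    bra_op (fun s => U s *m V (val s)) J.
Proof.
apply: ket_matrixP => c y; rewrite !mxE !big_kidx (sum_glue K).
rewrite [RHS](bigD1 (restr (~: K)%SET y)) //= [X in _ + X]big1 => [|d /negbTE hd]; last first.
  by rewrite bra_opE eq_sym hd mulr0.
rewrite addr0 bra_opE eqxx tens_opE.
transitivity (\sum_(b : ket (sub K)) tens_op U (kidx J) (kidx b) *
    (tens_op V (kidx (glue b c)) (kidx y))).
  apply: eq_bigr => b _; rewrite (bigD1 c) //= big1 => [|d /negbTE hd]; last first.
    by rewrite bra_opE restr_glueR hd mul0r.
  by rewrite addr0 bra_opE restr_glueR eqxx restr_glueL.
rewrite -tens_op_mul [X in _ * X]mxE big_kidx big_distrr /=; apply: eq_bigr => b _.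
rewrite mulrCA; congr (_ * _); rewrite !tens_opE (prod_glue K) mulrC; congr (_ * _).
  by apply: eq_bigr => s _; rewrite glueR ffunE.
by apply: eq_bigr => s _; rewrite glueL ffunE.
Qed.

(** Born's rule: both sides sum [rho] over strings [x] and [y] that agree outside [K], weighted by
    the amplitudes of [J]. For a pure state, probabilities become squared norms of contracted
    vectors. *)
Lemma measured_diag U J (rho : 'M[C]_(dimq T)) :
  (tens_op U *m reduced K rho *m (tens_op U)^t*) (kidx J) (kidx J) =
  \tr (bra_op U J *m rho *m (bra_op U J)^t*).
Proof.
pose u x := tens_op U (kidx J) (kidx (restr K x)).
transitivity (\sum_(x : ket T) \sum_(y : ket T | restr (~: K)%SET y == restr (~: K)%SET x)
   u x * rho (kidx x) (kidx y) * ((u y)^*)%R).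
  rewrite mxE big_kidx.
  under eq_bigr => q _ do rewrite mxE big_kidx big_distrl /=.
  rewrite exchange_big /=.
  transitivity (\sum_p \sum_(x | restr K x == p) \sum_q \sum_(y : ket T |
      (restr K y == q) && (restr (~: K)%SET y == restr (~: K)%SET x))
       tens_op U (kidx J) (kidx p) * rho (kidx x) (kidx y) *
       ((tens_op U)^t* (kidx q) (kidx J))).
    apply: eq_bigr => p _; rewrite exchange_big /=; apply: eq_bigr => q _.
    rewrite [X in _ * X * _]mxE !kidxK big_distrr big_distrl /=.
    by apply: eq_bigr => x _; rewrite big_distrr big_distrl.
  rewrite sum_fiber /=; apply: eq_bigr => x _.
  under eq_bigr => q _ do rewrite big_mkcondr.
  rewrite sum_fiber /= [RHS]big_mkcond; apply: eq_bigr => y _.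
  by case: ifP => // _; rewrite [X in _ * X]mxE [X in Num.conj X]mxE.
symmetry; rewrite /mxtrace big_kidx.
transitivity (\sum_c \sum_(x | restr (~: K)%SET x == c) \sum_(y : ket T | restr (~: K)%SET y == c)
   u x * rho (kidx x) (kidx y) * ((u y)^*)%R).
  apply: eq_bigr => c _; rewrite mxE big_kidx.
  under eq_bigr => y _ do rewrite mxE big_kidx big_distrl /=.
  rewrite exchange_big /= [RHS]big_mkcond; apply: eq_bigr => x _; case: ifP => hx.
    rewrite [RHS]big_mkcond; apply: eq_bigr => y _.
    rewrite bra_opE hx [X in _ * X]mxE [X in Num.conj X]mxE bra_opE.
    by case: ifP => _ //; rewrite conjC0 mulr0.
  by rewrite big1 // => y _; rewrite bra_opE hx !mul0r.
by rewrite sum_fiber.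
Qed.

End Measurement.

(** * Fully entangled fraction of a pure two-qubit state *)

Section ComplexModulus.
Variable R : realType.
Implicit Types z w : R[i].

Lemma normcC z : `|z| = (nc z)%:C. Proof. by []. Qed.

Lemma nc_ge0 z : 0 <= nc z.
Proof. by case: z => a b; exact: sqrtr_ge0. Qed.

Lemma nc_sqrE z : nc z ^+ 2 = complex.Re z ^+ 2 + complex.Im z ^+ 2.
Proof. by case: z => a b; rewrite /= sqr_sqrtr // addr_ge0 ?sqr_ge0. Qed.

Lemma mulzJ z : z * (z^*)%R = (nc z ^+ 2)%:C.
Proof. by rewrite -normCK normcC rmorphXn. Qed.

Lemma mulJz z : (z^*)%R * z = (nc z ^+ 2)%:C.
Proof. by rewrite mulrC mulzJ. Qed.

Lemma nc_conj z : nc (z^*)%R = nc z.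
Proof. by apply: complexI; rewrite -!normcC norm_conjC. Qed.

Lemma ncM z w : nc (z * w) = nc z * nc w.
Proof. exact: ComplexField.Normc.normcM. Qed.

Lemma ncD z w : nc (z + w) <= nc z + nc w.
Proof. exact: (@le_normcD R z w). Qed.

Lemma ncN z : nc (- z) = nc z.
Proof. exact: (@normcN R z). Qed.

Lemma ncR (r : R) : 0 <= r -> nc r%:C = r.
Proof. by move=> r0; rewrite /= expr0n addr0 sqrtr_sqr ger0_norm. Qed.

Lemma nc0 : nc (0 : R[i]) = 0.
Proof. exact: ComplexField.Normc.normc0. Qed.

Lemma nc_eq0 z : nc z = 0 -> z = 0.
Proof. exact: ComplexField.Normc.eq0_normc. Qed.

Lemma conjR (r : R) : ((r%:C : R[i])^*)%R = r%:C.
Proof. by rewrite -[LHS]/(conjc _) conjc_real. Qed.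

Lemma Re_sum (I : finType) (P : pred I) (F : I -> R[i]) :
  complex.Re (\sum_(i | P i) F i) = \sum_(i | P i) complex.Re (F i).
Proof. by apply: (big_morph (@complex.Re R)) => [[a b] [c d]|]. Qed.

Lemma Re_mulR (r : R) z : complex.Re (r%:C * z) = r * complex.Re z.
Proof. by case: z => a b /=; rewrite mul0r subr0. Qed.

Definition nrm2 n (phi : 'cV[R[i]]_n) : R := \sum_a nc (phi a 0) ^+ 2.

Lemma nrm2E n (phi : 'cV[R[i]]_n) : (phi^t* *m phi) 0 0 = (nrm2 phi)%:C.
Proof.
by rewrite mxE rmorph_sum; apply: eq_bigr => a _; rewrite !mxE mulJz.
Qed.

Lemma nrm2_ge0 n (phi : 'cV[R[i]]_n) : 0 <= nrm2 phi.
Proof. by apply: sumr_ge0 => a _; rewrite sqr_ge0. Qed.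

Lemma unit_nrm2 n (phi : 'cV[R[i]]_n) : unit_vector phi <-> nrm2 phi = 1.
Proof.
rewrite /unit_vector nrm2E; split=> [h|->//].
by apply: complexI; rewrite h.
Qed.

Lemma nrm2_eq0 n (phi : 'cV[R[i]]_n) : nrm2 phi = 0 -> phi = 0.
Proof.
move=> /psumr_eq0P h; apply/matrixP => a b; rewrite ord1 mxE; apply: nc_eq0.
by apply/eqP; rewrite -sqrf_eq0 h // => c _; rewrite sqr_ge0.
Qed.

Lemma nrm2_isometry m n (U : 'M[R[i]]_(m, n)) (phi : 'cV_n) :
  U^t* *m U = 1%:M -> nrm2 (U *m phi) = nrm2 phi.
Proof.
move=> hU; apply: complexI; rewrite -!nrm2E trmx_mul map_mxM.
by rewrite mulmxA -(mulmxA _ (U^t*)) hU mulmx1.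
Qed.

Lemma proj_ofE n (phi : 'cV[R[i]]_n) a b :
  proj_of phi a b = phi a 0 * ((phi b 0)^*)%R.
Proof. by rewrite mxE big_ord1 !mxE. Qed.

Lemma proj_of_mul m n (B : 'M[R[i]]_(m, n)) (phi : 'cV_n) :
  B *m proj_of phi *m B^t* = proj_of (B *m phi).
Proof. by rewrite /proj_of trmx_mul map_mxM !mulmxA. Qed.

Lemma tr_proj n (phi : 'cV[R[i]]_n) : \tr (proj_of phi) = (nrm2 phi)%:C.
Proof.
by rewrite rmorph_sum; apply: eq_bigr => a _; rewrite proj_ofE mulzJ.
Qed.

Lemma proj_expect n (e phi : 'cV[R[i]]_n) :
  (e^t* *m proj_of phi *m e) 0 0 = (nc ((e^t* *m phi) 0 0) ^+ 2)%:C.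
Proof.
rewrite /proj_of !mulmxA -mulmxA mxE big_ord1 -mulzJ; congr (_ * _).
rewrite !mxE rmorph_sum; apply: eq_bigr => a _.
by rewrite !mxE rmorphM /= conjCK mulrC.
Qed.

End ComplexModulus.

Lemma ord2P (P : 'I_2 -> Prop) : P ord0 -> P ord_max -> forall i, P i.
Proof.
by move=> h0 h1 [[|[|//]] hi]; [move: h0 | move: h1]; congr P; apply: val_inj.
Qed.

Lemma sum_ord2 (V : nmodType) (F : 'I_2 -> V) : \sum_i F i = F ord0 + F ord_max.
Proof. by rewrite big_ord_recl big_ord1; congr (_ + F _); apply: val_inj. Qed.

Lemma det2 (C : comPzRingType) (m : 'M[C]_2) :
  \det m = m ord0 ord0 * m ord_max ord_max - m ord0 ord_max * m ord_max ord0.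
Proof.
rewrite (expand_det_row _ ord0) sum_ord2 /cofactor !det_mx11 !mxE /= expr0 expr1.
rewrite mul1r mulN1r mulrN; congr (_ * m _ _ - _ * m _ _); exact: val_inj.
Qed.

(** * Overlaps of a two-by-two matrix with scaled unitaries *)

Section TwoByTwo.
Variable R : realType.
Local Notation C := R[i].
Implicit Types m e : 'M[C]_2.

Lemma tr_mulJ m : \tr (m *m m^t*) = (\sum_i \sum_j nc (m i j) ^+ 2)%:C.
Proof.
rewrite rmorph_sum; apply: eq_bigr => i _; rewrite mxE rmorph_sum.
by apply: eq_bigr => j _; rewrite !mxE mulzJ.
Qed.

Lemma det_adjmx n (m : 'M[C]_n) : \det (m^t*) = ((\det m)^*)%R.
Proof. by rewrite det_map_mx det_tr. Qed.

(** With entries a, b, c, d: expand |a + d|^2, bound |ad| by |det m| + |bc|, and 2|bc| by |b|^2 +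
    |c|^2. *)
Lemma trace_sqr_le m : nc (\tr m) ^+ 2 <=
  \sum_i \sum_j nc (m i j) ^+ 2 + 2 * nc (\det m).
Proof.
rewrite det2 /mxtrace !sum_ord2.
set a := m ord0 ord0; set b := m ord0 ord_max.
set c := m ord_max ord0; set d := m ord_max ord_max.
have h1 := ncD a d; have h2 : nc a * nc d <= nc (a * d - b * c) + nc b * nc c.
  by rewrite -!ncM -{1}(subrK (b * c) (a * d)) ncD.
have := nc_ge0 a; have := nc_ge0 b; have := nc_ge0 c; have := nc_ge0 d.
have := nc_ge0 (a + d); have := sqr_ge0 (nc b - nc c).
by nra.
Qed.

(** [e] is a unitary over the square root of 2, so multiplying [m] by its adjoint halves both the
    squared norm and the modulus of the determinant; [trace_sqr_le] then applies. *)
Lemma overlap_le e m : e *m e^t* = (2^-1)%:M ->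
  nc (\tr (e^t* *m m)) ^+ 2 <=
  (\sum_i \sum_j nc (m i j) ^+ 2) / 2 + nc (\det m).
Proof.
move=> he; apply: (le_trans (trace_sqr_le _)).
have de : nc (\det e) = 2^-1.
  have : nc (\det e) ^+ 2 = 2^-1 ^+ 2.
    apply: complexI; rewrite -mulzJ -det_adjmx -det_mulmx he det_scalar.
    by rewrite rmorphXn /= fmorphV rmorph_nat.
  by move/eqP; rewrite eqrXn2 ?nc_ge0 // ?invr_ge0 ?ler0n // => /eqP.
rewrite det_mulmx det_adjmx ncM nc_conj de mulrA divff ?pnatr_eq0 // mul1r.
rewrite lerD2r le_eqVlt; apply/orP; left; apply/eqP/complexI.
rewrite -tr_mulJ trmx_mul map_mxM trmxCK -mulmxA mxtrace_mulC.
rewrite -!mulmxA he mul_mx_scalar !linearZ /= tr_mulJ.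
by rewrite mulrC rmorphM /= fmorphV rmorph_nat.
Qed.

(* The maximizer is X / sqrt (2 k) with X = m + u conj(cofactor m), u the phase
   of det m and k = |m|^2 + 2 |det m|: if m = V S W is a singular value
   decomposition, then X = (s1 + s2) V W and k = (s1 + s2)^2. *)
Lemma overlap_attained m : exists2 e, e *m e^t* = (2^-1)%:M &
  nc (\tr (e^t* *m m)) ^+ 2 =
  (\sum_i \sum_j nc (m i j) ^+ 2) / 2 + nc (\det m).
Proof.
pose a := m ord0 ord0; pose b := m ord0 ord_max.
pose c := m ord_max ord0; pose d := m ord_max ord_max.
pose D := nc (\det m).
(* [u] is the phase of the determinant; for a singular [m] the value 1 is taken. *)
have [u u1 uD] : exists2 u : C, u * (u^*)%R = 1 & (u^*)%R * \det m = D%:C.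
  have [D0|D0] := eqVneq (\det m) 0.
    by exists 1; rewrite ?conjC1 ?mulr1 // /D D0 nc0 mulr0.
  have D1 : D != 0 by apply: contraNneq D0 => /nc_eq0 ->.
  have D2 : (D%:C : C) != 0 by rewrite (inj_eq (@complexI R) D 0).
  exists (\det m / D%:C); rewrite rmorphM /= fmorphV /= conjR.
    by rewrite mulrACA mulzJ -/D rmorphXn /=; field.
  by rewrite mulrAC mulJz -/D rmorphXn /=; field.
have uD' : u * ((\det m)^*)%R = D%:C.
  by rewrite -[u]conjCK -rmorphM uD /= conjR.
pose N := \sum_i \sum_j nc (m i j) ^+ 2.
have NE : (N%:C : C) = a * (a^*)%R + b * (b^*)%R + (c * (c^*)%R + d * (d^*)%R).
  by rewrite /N !sum_ord2 !mulzJ !rmorphD.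
have N0 : 0 <= N by apply: sumr_ge0 => i _; apply: sumr_ge0 => j _; rewrite sqr_ge0.
pose k := N + 2 * D.
have k0 : 0 <= k by rewrite addr_ge0 // mulr_ge0 ?nc_ge0.
rewrite det2 -/a -/b -/c -/d in uD.
rewrite det2 -/a -/b -/c -/d rmorphB !rmorphM /= in uD'.
(* Reversing both indices and alternating the sign yields the cofactor. *)
pose X : 'M[C]_2 := \matrix_(i, j)
  (m i j + u * (if i == j then 1 else -1) * ((m (rev_ord i) (rev_ord j))^*)%R).
have r0 : rev_ord ord0 = ord_max :> 'I_2 by apply: val_inj.
have r1 : rev_ord ord_max = ord0 :> 'I_2 by apply: val_inj.
have kE : k%:C = a * (a^*)%R + b * (b^*)%R + (c * (c^*)%R + d * (d^*)%R)
     + (u^*)%R * (a * d - b * c) + u * ((a^*)%R * (d^*)%R - (b^*)%R * (c^*)%R).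
  by rewrite uD uD' -NE /k rmorphD rmorphM rmorph_nat /=; ring.
have cm1 : ((-1 : C)^*)%R = -1 by rewrite rmorphN /= conjC1.
have XX : X *m X^t* = (k%:C)%:M.
  move: kE; generalize (k%:C) => kC kE.
  apply/matrixP; apply: ord2P; apply: ord2P; rewrite !mxE sum_ord2 !mxE /= ?r0 ?r1;
  rewrite -/a -/b -/c -/d !rmorphD !rmorphM /= ?conjCK ?cm1 ?conjC1 ?mulr1n ?mulr0n ?kE;
  ring: u1.
have Xm : \tr (X^t* *m m) = k%:C.
  move: kE; generalize (k%:C) => kC kE; rewrite kE.
  rewrite /mxtrace sum_ord2 !mxE !sum_ord2 !mxE /= ?r0 ?r1.
  rewrite -/a -/b -/c -/d !rmorphD !rmorphM /= ?conjCK ?cm1 ?conjC1.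
  (* Both sides are the real number |det m|. *)
  have -> : u * ((a^*)%R * (d^*)%R - (b^*)%R * (c^*)%R) = (u^*)%R * (a * d - b * c).
    by rewrite uD uD'.
  ring.
(* For [k = 0] the normalization breaks down, but then [m = 0] and any admissible [e] attains the
   value 0. *)
have [k_eq0|k_neq0] := eqVneq k 0.
  have N_eq0 : N = 0 by have := nc_ge0 (\det m); rewrite -/D /k in k_eq0 *; lra.
  have m0 : m = 0.
    apply/matrixP => i j; rewrite mxE; apply: nc_eq0; apply/eqP.
    rewrite -sqrf_eq0; apply/eqP.
    apply: (@psumr_eq0P _ _ xpredT (fun j => nc (m i j) ^+ 2)) => // [j' _|]; rewrite ?sqr_ge0 //.
    apply: (@psumr_eq0P _ _ xpredT (fun i => \sum_j nc (m i j) ^+ 2)) => // i' _; apply: sumr_ge0 => j' _; exact: sqr_ge0.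
  exists ((Num.sqrt 2^-1)%:C%:M).
    rewrite tr_scalar_mx map_scalar_mx /= conjR -scalar_mxM -rmorphM /=.
    by rewrite -expr2 sqr_sqrtr ?invr_ge0 ?ler0n // fmorphV rmorph_nat.
  rewrite -/N N_eq0 m0 mulmx0 mxtrace0 nc0 det2 !mxE mul0r subrr nc0; ring.
have k_gt0 : 0 < k by rewrite lt_def k_neq0.
pose r : R := (Num.sqrt (2 * k))^-1.
have r_ge0 : 0 <= r by rewrite invr_ge0 sqrtr_ge0.
have r2 : r ^+ 2 * k = 2^-1.
  by rewrite exprVn sqr_sqrtr ?mulr_ge0 ?ler0n //; field.
exists (r%:C *: X).
  rewrite linearZ /= map_mxZ /= conjR -scalemxAl -scalemxAr XX scalerA.
  rewrite scale_scalar_mx -!rmorphM /= -expr2 r2; congr (_%:M).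
  by rewrite fmorphV rmorph_nat.
rewrite linearZ /= map_mxZ /= conjR -scalemxAl linearZ /= Xm ncM !ncR //.
by rewrite exprMn -/N -/D [k ^+ 2]expr2 mulrA r2 /k; field.
Qed.

End TwoByTwo.

(** * Two-qubit vectors as two-by-two matrices *)

Section FullyEntangledFraction.
Variables (R : realType) (T : finType) (s t : T).
Hypotheses (st : s != t) (T2 : forall x, (x == s) || (x == t)).
Local Notation C := R[i].

(** On a two-party register every party other than [s] is [t], so naming [s] fixes the string.
    Exchanging [s] and [t] transposes the coefficient matrix. *)
Definition pairket (s : T) (a b : 'I_2) : ket T :=
  [ffun x => if x == s then a else b].

Definition coefmx (s : T) (phi : 'cV[C]_(dimq T)) : 'M[C]_2 :=
  \matrix_(a, b) phi (kidx (pairket s a b)) 0.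

Lemma pairket_restr (x : ket T) : pairket s (x s) (x t) = x.
Proof.
apply/ffunP => z; rewrite ffunE; case: eqVneq => [->//|zs].
by have := T2 z; rewrite (negbTE zs) => /eqP ->.
Qed.

Lemma pairketl a b : pairket s a b s = a. Proof. by rewrite ffunE eqxx. Qed.
Lemma pairketr a b : pairket s a b t = b.
Proof. by rewrite ffunE eq_sym (negbTE st). Qed.

Lemma sum_pairket (V : nmodType) (F : ket T -> V) :
  \sum_x F x = \sum_a \sum_b F (pairket s a b).
Proof.
rewrite pair_big /= (reindex (fun p => pairket s p.1 p.2)) //=.
exists (fun x => (x s, x t)) => [[a b] _|x _] /=; last exact: pairket_restr.
by rewrite pairketl pairketr.
Qed.

Lemma coefmxK (m : 'M[C]_2) : coefmx s (\col_a m (kval a s) (kval a t)) = m.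
Proof. by apply/matrixP => a b; rewrite !mxE kidxK pairketl pairketr. Qed.

Lemma nrm2_coefmx phi :
  nrm2 phi = \sum_i \sum_j nc (coefmx s phi i j) ^+ 2.
Proof.
rewrite /nrm2 big_kidx sum_pairket.
by apply: eq_bigr => i _; apply: eq_bigr => j _; rewrite mxE.
Qed.

Lemma overlap_coefmx (e phi : 'cV[C]_(dimq T)) :
  (e^t* *m phi) 0 0 = \tr ((coefmx s e)^t* *m coefmx s phi).
Proof.
rewrite mxE big_kidx sum_pairket /mxtrace exchange_big; apply: eq_bigr => j _.
by rewrite mxE; apply: eq_bigr => i _; rewrite !mxE.
Qed.

Lemma reduced_coefmx (e : 'cV[C]_(dimq T)) p q :
  reduced [set s]%SET (proj_of e) (kidx p) (kidx q) =
  (coefmx s e *m (coefmx s e)^t*) (p (exist _ s (finset.set11 s))) (q (exist _ s (finset.set11 s))).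
Proof.
have rE (x : ket T) (r : ket (sub [set s]%SET)) :
    (restr [set s]%SET x == r) = (x s == r (exist _ s (finset.set11 s))).
  apply/eqP/eqP => [<-|h]; first by rewrite ffunE.
  apply/ffunP => -[z hz]; rewrite ffunE /=.
  have zs := hz; move: zs; rewrite finset.in_set1 => /eqP zs; subst z.
  by rewrite h; congr (r _); apply: val_inj.
have rC (x y : ket T) : (restr (~: [set s])%SET x == restr (~: [set s])%SET y) =
    (x t == y t).
  have ht : t \in (~: [set s])%SET by rewrite !inE eq_sym.
  apply/eqP/eqP => [/ffunP /(_ (exist _ t ht))|h]; first by rewrite !ffunE.
  apply/ffunP => -[z hz]; rewrite !ffunE /=.
  by have := T2 z; move: hz; rewrite !inE => /negbTE -> /eqP ->.
rewrite mxE !kidxK; under eq_bigl do rewrite rE.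
rewrite big_mkcond sum_pairket (bigD1 (p (exist _ s (finset.set11 s)))) //=.
rewrite [X in _ + X]big1 ?addr0 => [|i hi]; last first.
  by rewrite big1 // => j _; rewrite pairketl (negbTE hi).
rewrite [RHS]mxE; apply: eq_bigr => b _; rewrite pairketl eqxx.
under eq_bigl do rewrite rE rC pairketr.
rewrite big_mkcond sum_pairket (bigD1 (q (exist _ s (finset.set11 s)))) //=.
rewrite [X in _ + X]big1 ?addr0 => [|i hi]; last first.
  by rewrite big1 // => j _; rewrite pairketl (negbTE hi).
rewrite (bigD1 b) //= [X in _ + X]big1 ?addr0 => [|j hj]; last first.
  by rewrite pairketr (negbTE hj) andbF.
by rewrite pairketl pairketr !eqxx /= proj_ofE !mxE.
Qed.

Lemma reduced_half (e : 'cV[C]_(dimq T)) :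
  reduced [set s]%SET (proj_of e) = (2^-1)%:M <->
  coefmx s e *m (coefmx s e)^t* = (2^-1)%:M.
Proof.
split=> [h|h].
  apply/matrixP => a b.
  have := reduced_coefmx e [ffun=> a] [ffun=> b]; rewrite !ffunE => <-.
  rewrite h !mxE kidx_eq; congr (_ *+ (_ : bool)).
  by apply/eqP/eqP => [/ffunP /(_ (exist _ s (finset.set11 s)))|->//]; rewrite !ffunE.
apply: ket_matrixP => p q; rewrite reduced_coefmx h !mxE kidx_eq.
congr (_ *+ (_ : bool)); apply/eqP/eqP => [pq|->//].
apply/ffunP => -[z hz]; have zs := hz; move: zs; rewrite finset.in_set1 => /eqP zs; subst z.
by move: pq; congr (p _ = q _); apply: val_inj.
Qed.

End FullyEntangledFraction.

Section FefPure.
Variables (R : realType) (T : finType) (s t : T).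
Hypotheses (st : s != t) (T2 : forall x, (x == s) || (x == t)).
Local Notation C := R[i].

Lemma pairketC a b : pairket t a b = pairket s b a.
Proof.
apply/ffunP => z; rewrite !ffunE; case: eqVneq => [->|zt].
  by rewrite eq_sym (negbTE st).
by have := T2 z; rewrite (negbTE zt) orbF => ->.
Qed.

(** The marginal at [s] decides: it makes the coefficient matrix a multiple of a unitary, whose left
    and right inverses agree, and this gives the marginal at [t]. The trace gives the norm. *)
Lemma max_entangled_coefmx (e : 'cV[C]_(dimq T)) :
  max_entangled e <-> coefmx s e *m (coefmx s e)^t* = (2^-1)%:M.
Proof.
have ts : t != s by rewrite eq_sym.
have T2' z : (z == t) || (z == s) by rewrite orbC.
split=> [[_ h]|h]; first exact: (iffLR (reduced_half st T2 e) (h s)).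
split.
  apply/unit_nrm2; apply: complexI; rewrite (nrm2_coefmx st T2) -tr_mulJ h.
  by rewrite mxtrace_scalar -[LHS]mulr_natl divff ?pnatr_eq0.
move=> z; have := T2 z => /orP[] /eqP ->; first exact: (iffRL (reduced_half st T2 e) h).
apply/(reduced_half ts T2'); set n := coefmx s e.
have -> : coefmx t e = n^T by apply/matrixP => a b; rewrite !mxE pairketC.
have h2 : n^t* *m n = (2^-1)%:M.
  have h1 : n *m (2 *: n^t*) = 1%:M.
    by rewrite -scalemxAr h scale_scalar_mx divff ?pnatr_eq0.
  have := mulmx1C h1; rewrite -scalemxAl => /(congr1 (fun m => 2^-1 *: m)).
  by rewrite scalerA mulVf ?pnatr_eq0 // scale1r scale_scalar_mx mulr1.
have := congr1 trmx h2; rewrite trmx_mul tr_scalar_mx => <-.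
by congr (_ *m _); apply/matrixP => a b; rewrite !mxE.
Qed.

(** Stated for vectors of any norm, because it is applied to unnormalized post-measurement
    vectors. *)
Lemma fef_proj (phi : 'cV[C]_(dimq T)) :
  fef (proj_of phi) = nrm2 phi / 2 + nc (\det (coefmx s phi)).
Proof.
rewrite /fef; set S := (X in sup X).
have Sub : ubound S (nrm2 phi / 2 + nc (\det (coefmx s phi))).
  move=> _ [e /max_entangled_coefmx he ->].
  rewrite proj_expect /= (overlap_coefmx st T2) (nrm2_coefmx st T2).
  exact: overlap_le.
have Smem : S (nrm2 phi / 2 + nc (\det (coefmx s phi))).
  have [m hm vm] := overlap_attained (coefmx s phi).
  exists (\col_a m (kval a s) (kval a t)).
    by apply/max_entangled_coefmx; rewrite (coefmxK st).
  by rewrite proj_expect /= (overlap_coefmx st T2) (coefmxK st) vm (nrm2_coefmx st T2).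
apply/eqP; rewrite eq_le ge_sup //; last by exists (nrm2 phi / 2 + nc (\det (coefmx s phi))).
by apply: ub_le_sup => //; exists (nrm2 phi / 2 + nc (\det (coefmx s phi))).
Qed.

End FefPure.

(** * Measured fully entangled fraction of a pure state *)

Section Suprema.
Variables (R : realType) (I : Type) (D : I -> Prop).
Implicit Type f : I -> R.

Local Notation supD f := (sup [set v | exists2 x, D x & v = f x]%classic).

Lemma le_supD f c x : (forall y, D y -> f y <= c) -> D x -> f x <= supD f.
Proof.
move=> fc Dx; apply: ub_le_sup; last by exists x.
by exists c => _ [y Dy ->]; exact: fc.
Qed.

Lemma supD_le f c x : D x -> (forall y, D y -> f y <= c) -> supD f <= c.
Proof.
move=> Dx fc; apply: ge_sup; first by exists (f x); exists x.
by move=> _ [y Dy ->]; exact: fc.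
Qed.

Lemma supD_scale f r c x : D x -> (forall y, D y -> f y <= c) -> 0 <= r ->
  supD (fun y => r * f y) = r * supD f.
Proof.
move=> Dx fc r0; apply/eqP; rewrite eq_le; apply/andP; split.
  apply: (supD_le Dx) => y Dy; apply: ler_wpM2l => //.
  exact: le_supD fc Dy.
have [->|r_neq0] := eqVneq r 0.
  rewrite mul0r -[X in X <= _](mul0r (f x)).
  by apply: (@le_supD (fun y => 0 * f y) 0 x) => // y _; rewrite mul0r.
have rp : 0 < r by rewrite lt_def r_neq0.
rewrite mulrC -ler_pdivlMr //; apply: (supD_le Dx) => y Dy.
rewrite ler_pdivlMr // mulrC; apply: (@le_supD (fun y => r * f y) (r * c)) => // z Dz.
by rewrite ler_pM2l ?fc.
Qed.

End Suprema.

(** * Unnormalized post-measurement vectors *)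

Section Contraction.
Variables (R : realType).
Local Notation C := R[i].

(* <a| applied to all parties but s and t, seen as a matrix. *)
Definition contr (T : finType) (s t : T) (a : T -> 'I_2 -> C)
    (phi : 'cV[C]_(dimq T)) : 'M[C]_2 :=
  \matrix_(x, y) \sum_(z : ket T | (z s == x) && (z t == y))
    (\prod_(u | u \notin [set s; t]%SET) a u (z u)) * phi (kidx z) 0.

Lemma scale_proj n (c : R) (v : 'cV[C]_n) :
  proj_of (c%:C *: v) = (c ^+ 2)%:C *: proj_of v.
Proof.
apply/matrixP => a b; rewrite proj_ofE [RHS]mxE proj_ofE !mxE rmorphM /= conjR rmorphXn /=.
ring.
Qed.

Lemma nrm2_scale n (c : R) (v : 'cV[C]_n) :
  nrm2 (c%:C *: v) = c ^+ 2 * nrm2 v.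
Proof.
rewrite /nrm2 big_distrr; apply: eq_bigr => a _; rewrite mxE ncM exprMn.
by congr (_ * _); rewrite nc_sqrE /= expr0n addr0.
Qed.

(** Homogeneity of degree 2 absorbs the normalization, and at probability 0 both sides vanish. From
    here on only unnormalized vectors occur. *)
Lemma weighted_post n (F : 'M[C]_n -> R) (v : 'cV[C]_n) :
  (forall (c : R) w, F (proj_of (c%:C *: w)) = c ^+ 2 * F (proj_of w)) ->
  nrm2 v * F (((nrm2 v)^-1)%:C *: proj_of v) = F (proj_of v).
Proof.
move=> hF; have [v0|v0] := eqVneq (nrm2 v) 0.
  rewrite v0 mul0r (nrm2_eq0 v0).
  by rewrite -[X in proj_of X](scale0r 0) (hF 0) expr0n mul0r.
have vp : 0 < nrm2 v by rewrite lt_def v0 nrm2_ge0.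
have -> : (nrm2 v)^-1 = (Num.sqrt (nrm2 v))^-1 ^+ 2.
  by rewrite exprVn sqr_sqrtr // nrm2_ge0.
rewrite -scale_proj hF exprVn sqr_sqrtr ?nrm2_ge0 //.
by rewrite mulrA divff ?mul1r.
Qed.

Lemma prob_proj (T : finType) (K : {set T}) (U : sub K -> 'M[C]_2) J
    (phi : 'cV_(dimq T)) :
  prob U J (proj_of phi) = nrm2 (bra_op U J *m phi).
Proof. by rewrite /prob measured_diag proj_of_mul tr_proj. Qed.

Lemma sum_nrm2_bra (T : finType) (K : {set T}) (U : sub K -> 'M[C]_2)
    (phi : 'cV_(dimq T)) : (forall k, U k \is unitarymx) ->
  \sum_J nrm2 (bra_op U J *m phi) = nrm2 phi.
Proof.
move=> hU; apply: complexI; rewrite rmorph_sum /=.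
under eq_bigr => J _ do rewrite -nrm2E trmx_mul map_mxM mulmxA -(mulmxA _ _ (bra_op U J)).
rewrite -nrm2E -[in RHS](mulmx1 (phi^t*)) -(bra_op_complete hU).
by rewrite mulmx_sumr mulmx_suml summxE.
Qed.

(** Triangle inequality and arithmetic-geometric mean. It keeps the fully entangled fraction of a
    vector below its squared norm. *)
Lemma nc_det_le (m : 'M[C]_2) :
  nc (\det m) <= (\sum_i \sum_j nc (m i j) ^+ 2) / 2.
Proof.
rewrite det2 !sum_ord2.
set a := m ord0 ord0; set b := m ord0 ord_max.
set c := m ord_max ord0; set d := m ord_max ord_max.
have := ncD (a * d) (- (b * c)); rewrite ncN !ncM.
have := sqr_ge0 (nc a - nc d); have := sqr_ge0 (nc b - nc c).
by nra.
Qed.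

End Contraction.

Section PairPure.
Variables (R : realType) (T : finType) (s t : T).
Hypothesis st : s != t.
Local Notation C := R[i].
Local Notation P := [set s; t]%SET.
Local Notation S := (sub (~: ~: P)%SET).

(** The unmeasured parties form the complement of the measured set [~: P], which is not convertible
    to [P]; hence the copies [s'] and [t']. *)
Let hs : s \in (~: ~: P)%SET. Proof. by rewrite !inE eqxx. Qed.
Let ht : t \in (~: ~: P)%SET. Proof. by rewrite !inE eqxx orbT. Qed.
Let s' : S := exist _ s hs.
Let t' : S := exist _ t ht.
Let st' : s' != t'. Proof. exact: st. Qed.
Let S2 (x : S) : (x == s') || (x == t').
Proof. by have := valP x; rewrite !inE negbK. Qed.

(** Only the values of [a] on measured parties enter, so rows of the measuring unitaries may be
    extended arbitrarily to [s] and [t]. *)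
Lemma coefmx_bra (U : sub (~: P)%SET -> 'M[C]_2) (J : ket (sub (~: P)%SET)) a (phi : 'cV_(dimq T)) :
  (forall u, a (val u) = U u (J u)) ->
  coefmx s' (bra_op U J *m phi) = contr s t a phi.
Proof.
move=> ha; apply/matrixP => x y; rewrite mxE bra_op_apply mxE.
apply: eq_big => [z|z _].
  apply/eqP/andP => [h|[/eqP zx /eqP zy]].
    have := congr1 (fun f : ket S => f s') h; have := congr1 (fun f : ket S => f t') h.
    by rewrite pairketl (pairketr st') !ffunE /= => -> ->; rewrite !eqxx.
  apply/ffunP => w; rewrite !ffunE; have := S2 w.
  by case/orP => /eqP ->; rewrite /= ?eqxx ?zx // eq_sym (negbTE st') zy.
congr (_ * _).
transitivity (\prod_(u in (~: P)%SET) a u (z u)).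
  by rewrite (big_sub (mem (~: P)%SET)) /=; apply: eq_bigr => u _; rewrite -ha.
by apply: eq_bigl => u; rewrite inE.
Qed.

Lemma fef_scale (c : R) (w : 'cV[C]_(dimq S)) :
  fef (proj_of (c%:C *: w)) = c ^+ 2 * fef (proj_of w).
Proof.
rewrite !(fef_proj st' S2) nrm2_scale.
have -> : coefmx s' (c%:C *: w) = c%:C *: coefmx s' w.
  by apply/matrixP => x y; rewrite !mxE.
have cc : (c%:C : C) ^+ 2 = (c ^+ 2)%:C by rewrite rmorphXn.
by rewrite detZ ncM cc ncR ?sqr_ge0 //; ring.
Qed.

Definition pair_value (U : sub (~: P)%SET -> 'M[C]_2) phi : R :=
  \sum_J fef (proj_of (bra_op U J *m phi)).

Lemma fpair_proj (phi : 'cV[C]_(dimq T)) :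
  fpair P (proj_of phi) = sup [set v | exists2 U : sub (~: P)%SET -> 'M[C]_2,
    (forall k, U k \is unitarymx) & v = pair_value U phi]%classic.
Proof.
congr sup; apply/seteqP; split=> v [U hU ->]; exists U => //;
apply: eq_bigr => J _; rewrite /post_state prob_proj proj_of_mul;
by rewrite weighted_post // => c w; exact: fef_scale.
Qed.

(** The norm terms add up to a constant by completeness, which leaves only determinants to
    optimize. *)
Lemma pair_valueE U phi : (forall k, U k \is unitarymx) ->
  pair_value U phi =
  nrm2 phi / 2 + \sum_J nc (\det (coefmx s' (bra_op U J *m phi))).
Proof.
move=> hU; rewrite /pair_value; under eq_bigr do rewrite (fef_proj st' S2).
by rewrite big_split -mulr_suml sum_nrm2_bra.
Qed.

Lemma pair_value_le U phi : (forall k, U k \is unitarymx) ->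
  pair_value U phi <= nrm2 phi.
Proof.
move=> hU; rewrite pair_valueE // [leRHS]splitr lerD2l.
rewrite -(sum_nrm2_bra phi hU) mulr_suml; apply: ler_sum => J _.
by rewrite (nrm2_coefmx st' S2) nc_det_le.
Qed.

Lemma unitary1 n : (1%:M : 'M[C]_n) \is unitarymx.
Proof. by apply/unitarymxP; rewrite trmx1 map_mx1 mulmx1. Qed.

(** Needed for the barred quantities, where [fpair] is itself evaluated on a normalized
    post-measurement state. *)
Lemma fpair_scale (c : R) (w : 'cV[C]_(dimq T)) :
  fpair P (proj_of (c%:C *: w)) = c ^+ 2 * fpair P (proj_of w).
Proof.
rewrite !fpair_proj -(@supD_scale _ _ _ _ _ (nrm2 w) (fun _ => 1%:M)) ?sqr_ge0 //.
- congr sup; apply/seteqP; split=> v [U hU ->]; exists U => //; rewrite big_distrr;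
  by apply: eq_bigr => J _; rewrite -scalemxAr fef_scale.
- by move=> k; exact: unitary1.
- by move=> U hU; exact: pair_value_le.
Qed.

Lemma fpair_le_nrm2 (phi : 'cV[C]_(dimq T)) : fpair P (proj_of phi) <= nrm2 phi.
Proof.
rewrite fpair_proj; apply: (@supD_le _ _ _ _ _ (fun _ => 1%:M)) => [k|U hU].
  exact: unitary1.
exact: pair_value_le.
Qed.

(** Of the nonnegative determinant terms only the one of outcome [J] is kept. *)
Lemma fpair_ge_contr (phi : 'cV[C]_(dimq T)) (U : T -> 'M[C]_2) (J : T -> 'I_2) :
  (forall u, U u \is unitarymx) ->
  nrm2 phi / 2 + nc (\det (contr s t (fun u => U u (J u)) phi)) <=
  fpair P (proj_of phi).
Proof.
move=> hU; rewrite fpair_proj.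
apply: (@le_trans _ _ (pair_value (fun u => U (val u)) phi)).
  rewrite pair_valueE // lerD2l (bigD1 [ffun u => J (val u)]) //=.
  rewrite (@coefmx_bra _ _ (fun u => U u (J u))); last by move=> u; rewrite ffunE.
  by rewrite lerDl; apply: sumr_ge0 => J' _; exact: nc_ge0.
apply: (@le_supD _ _ _ (pair_value^~ phi) (nrm2 phi)) => // V hV.
exact: pair_value_le.
Qed.

Lemma fpair_ge_half (phi : 'cV[C]_(dimq T)) :
  nrm2 phi / 2 <= fpair P (proj_of phi).
Proof.
have h := @fpair_ge_contr phi (fun _ => 1%:M) (fun _ => ord0) (fun _ => unitary1 _).
by apply: le_trans h; rewrite lerDl nc_ge0.
Qed.

Lemma fpair_le_half (phi : 'cV[C]_(dimq T)) :
  (forall a, \det (contr s t a phi) = 0) -> fpair P (proj_of phi) <= nrm2 phi / 2.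
Proof.
move=> h; rewrite fpair_proj; apply: (@supD_le _ _ _ _ _ (fun _ => 1%:M)) => [k|U hU].
  exact: unitary1.
rewrite pair_valueE // big1 ?addr0 // => J _.
(* The measured rows, extended by 0 to the two unmeasured parties. *)
pose a u := if insub u : option (sub (~: P)%SET) is Some v then U v (J v)
  else fun _ => 0.
rewrite (@coefmx_bra _ _ a) ?h ?nc0 // => u.
by apply: funext => x; rewrite /a valK.
Qed.

(** The coefficient matrix is multiplied by a unitary on the left and a transposed unitary on the
    right, with determinants of modulus 1. *)
Lemma fef_tens (w : 'cV[C]_(dimq S)) (W : S -> 'M[C]_2) :
  (forall u, W u \is unitarymx) ->
  fef (proj_of (tens_op W *m w)) = fef (proj_of w).
Proof.
move=> hW; rewrite !(fef_proj st' S2); congr (_ / _ + _).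
  apply: nrm2_isometry; apply: mulmx1C; apply/unitarymxP.
  exact: tens_op_unitary.
have -> : coefmx s' (tens_op W *m w) = W s' *m coefmx s' w *m (W t')^T.
  apply/matrixP => x y; rewrite !mxE big_kidx (sum_pairket st' S2).
  rewrite exchange_big; apply: eq_bigr => q _; rewrite mxE big_distrl.
  apply: eq_bigr => p _; rewrite tens_opE (bigD1 s') // (bigD1 t') /=; last first.
    by rewrite eq_sym.
  rewrite big1 => [|u /andP[us ut]]; last first.
    by have := S2 u; rewrite (negbTE us) (negbTE ut).
  by rewrite !pairketl !(pairketr st') !mxE; ring.
rewrite !det_mulmx det_tr !ncM.
have det1 (M : 'M[C]_2) : M \is unitarymx -> nc (\det M) = 1.
  move=> /unitarymxP /(congr1 determinant); rewrite det_mulmx det_adjmx mulzJ det1.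
  move=> /complexI h; apply/eqP.
  by rewrite -(@eqrXn2 _ 2) ?nc_ge0 ?ler01 // expr1n h.
by rewrite (det1 (W s')) // (det1 (W t')) // mul1r mulr1.
Qed.

(** Absorbing [V] into the measured bases permutes the tuples of unitaries, and [fef] ignores the
    other two factors. *)
Lemma fpair_tens (phi : 'cV[C]_(dimq T)) (V : T -> 'M[C]_2) :
  (forall u, V u \is unitarymx) ->
  fpair P (proj_of (tens_op V *m phi)) = fpair P (proj_of phi).
Proof.
move=> hV; rewrite !fpair_proj.
have valV U : pair_value U (tens_op V *m phi) =
    pair_value (fun k => U k *m V (val k)) phi.
  by apply: eq_bigr => J _; rewrite mulmxA bra_op_tens -mulmxA fef_tens.
apply: f_equal; apply/seteqP; split=> v [U hU ->].
  exists (fun k => U k *m V (val k)); last exact: valV.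
  by move=> k; exact: mul_unitarymx.
exists (fun k => U k *m (V (val k))^t*).
  by move=> k; apply: mul_unitarymx; rewrite ?trmxC_unitary.
rewrite valV; apply: f_equal2 => //; apply: funext => k.
by rewrite mulmxKtV.
Qed.

End PairPure.

(** * Spaces of matrices of rank at most one *)

Section RankOne.
Variable F : numFieldType.

(** The product has infinitely many roots. This upgrades an alternative that may depend on [t] to a
    uniform one. *)
Lemma poly_prod_eq0 (p q : {poly F}) :
  (forall t, p.[t] * q.[t] = 0) -> p = 0 \/ q = 0.
Proof.
move=> h; suff : p * q == 0.
  by rewrite mulf_eq0 => /orP[] /eqP; [left | right].
apply: contraT => pq0.
have := @max_poly_roots _ (p * q) [seq n%:R | n <- iota 0 (size (p * q))] pq0.
rewrite size_map size_iota ltnn; apply.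
  by apply/allP => x _; rewrite /root hornerM h.
by rewrite map_inj_uniq ?iota_uniq // => m n /eqP; rewrite eqr_nat => /eqP.
Qed.

Lemma quadratic_eq0 (a b c : F) :
  (forall t, a + b * t + c * t ^+ 2 = 0) -> [/\ a = 0, b = 0 & c = 0].
Proof.
move=> h; have h0 := h 0; have h1 := h 1; have h2 := h (-1).
have a0 : a = 0 by rewrite -h0; ring.
have two : (2 : F) != 0 by rewrite pnatr_eq0.
have c0 : c = 0.
  apply: (mulfI two); rewrite mulr0 -[RHS](subrr 0) -{1}h1 -[in RHS](oppr0 F).
  by rewrite -{1}h2 a0; ring.
by split=> //; rewrite -h1 a0 c0; ring.
Qed.

(** The row and the column through a nonzero entry serve as factors. *)
Lemma rank_one_factor (X Y : Type) (N : X -> Y -> F) :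
  (forall x x' y y', N x y * N x' y' = N x y' * N x' y) ->
  exists u v, forall x y, N x y = u x * v y.
Proof.
move=> h; have [[x0 [y0 n0]]|h0] := pselect (exists x y, N x y != 0).
  exists (fun x => N x y0), (fun y => N x0 y / N x0 y0) => x y.
  by rewrite mulrA h mulfK.
exists (fun _ => 0), (fun _ => 0) => x y; rewrite mulr0; apply/eqP.
by apply: contrapT => /negP n; apply: h0; exists x, y.
Qed.

(* A pencil of matrices of rank at most 1 has a common column space or a
   common row space. *)
Lemma rank_one_pencil (X Y : Type) (N : 'I_2 -> X -> Y -> F) :
  (forall t x x' y y',
     (N ord0 x y + t * N ord_max x y) * (N ord0 x' y' + t * N ord_max x' y') =
     (N ord0 x y' + t * N ord_max x y') * (N ord0 x' y + t * N ord_max x' y)) ->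
  (forall p q x x' y y', N p x y * N q x' y' = N p x' y * N q x y') \/
  (forall p q x x' y y', N p x y * N q x' y' = N p x y' * N q x' y).
Proof.
move=> h.
have coef x x' y y' :
    [/\ N ord0 x y * N ord0 x' y' - N ord0 x y' * N ord0 x' y = 0,
        N ord0 x y * N ord_max x' y' + N ord_max x y * N ord0 x' y' -
        (N ord0 x y' * N ord_max x' y + N ord_max x y' * N ord0 x' y) = 0 &
        N ord_max x y * N ord_max x' y' - N ord_max x y' * N ord_max x' y = 0].
  apply: quadratic_eq0 => t; have /eqP := h t x x' y y'; rewrite -subr_eq0.
  by move/eqP => <-; ring.
have [|u0 [v0 e0]] := @rank_one_factor _ _ (N ord0).
  by move=> x x' y y'; apply/eqP; rewrite -subr_eq0; case: (coef x x' y y') => ->.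
have [|u1 [v1 e1]] := @rank_one_factor _ _ (N ord_max).
  by move=> x x' y y'; apply/eqP; rewrite -subr_eq0; case: (coef x x' y y') => _ _ ->.
(* The coefficient of [t] in a minor is the product of a minor of ([u0], [u1]) and a minor of ([v0],
   [v1]), so one of the two pairs is proportional. *)
have mixed x x' y y' :
    (u0 x * u1 x' - u1 x * u0 x') * (v0 y * v1 y' - v0 y' * v1 y) = 0.
  by case: (coef x x' y y') => _ + _; rewrite !e0 !e1 => <-; ring.
have [[x [x' n0]]|uu] := pselect (exists x x', u0 x * u1 x' - u1 x * u0 x' != 0).
  right; have vv y y' : v0 y * v1 y' = v0 y' * v1 y.
    by apply/eqP; rewrite -subr_eq0; have /eqP := mixed x x' y y'; rewrite mulf_eq0 (negbTE n0).
  apply: ord2P; apply: ord2P => z z' y y'; rewrite ?e0 ?e1.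
  - ring.
  - by rewrite mulrACA vv; ring.
  - by rewrite mulrACA [v1 _ * _]mulrC vv; ring.
  - ring.
left; have {}uu x x' : u0 x * u1 x' = u1 x * u0 x'.
  by apply/eqP; rewrite -subr_eq0; apply: contrapT => /negP n; apply: uu; exists x, x'.
apply: ord2P; apply: ord2P => x x' y y'; rewrite ?e0 ?e1.
- ring.
- by rewrite mulrACA uu; ring.
- by rewrite mulrACA -uu; ring.
- ring.
Qed.

(** The alternatives are rank one across x | yuv, xu | yv, xv | yu and xuv | y. With the third index
    contracted by (1, t), the pencil in [v] has a common column or row space, the same kind for all
    t. Accordingly [v] is merged with the column index [y] or the row index [x], and the pencil in
    [u] decides the side of [u]. *)
Lemma rank_one_bipencil (W : 'I_2 -> 'I_2 -> 'I_2 -> 'I_2 -> F) :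
  (forall a b x x' y y', let M x y := \sum_u \sum_v a u * b v * W x y u v in
     M x y * M x' y' = M x y' * M x' y) ->
  [\/ forall x y u v x' y' u' v', W x y u v * W x' y' u' v' = W x y' u' v' * W x' y u v,
      forall x y u v x' y' u' v', W x y u v * W x' y' u' v' = W x y' u v' * W x' y u' v,
      forall x y u v x' y' u' v', W x y u v * W x' y' u' v' = W x y' u' v * W x' y u v' |
      forall x y u v x' y' u' v', W x y u v * W x' y' u' v' = W x y' u v * W x' y u' v'].
Proof.
move=> h; pose N t v x y := W x y ord0 v + t * W x y ord_max v.
pose col t := forall p q x x' y y', N t p x y * N t q x' y' = N t p x' y * N t q x y'.
pose row t := forall p q x x' y y', N t p x y * N t q x' y' = N t p x y' * N t q x' y.
have colrow t : col t \/ row t.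
  apply: rank_one_pencil => t' x x' y y'.
  pose e (r : F) (i : 'I_2) := if i == ord0 then 1 else r.
  have := h (e t) (e t') x x' y y'; rewrite /= !sum_ord2 /e /= /N => /eqP.
  rewrite -subr_eq0 => /eqP E; apply/eqP; rewrite -subr_eq0 -E; apply/eqP; ring.
pose Np v x y : {poly F} := (W x y ord0 v)%:P + 'X * (W x y ord_max v)%:P.
have NpE t v x y : (Np v x y).[t] = N t v x y by rewrite /Np !hornerE.
pose Pc p q x x' y y' := Np p x y * Np q x' y' - Np p x' y * Np q x y'.
pose Pr p q x x' y y' := Np p x y * Np q x' y' - Np p x y' * Np q x' y.
have PcE t p q x x' y y' : (Pc p q x x' y y').[t] =
    N t p x y * N t q x' y' - N t p x' y * N t q x y'.
  by rewrite /Pc hornerD hornerN !hornerM !NpE.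
have PrE t p q x x' y y' : (Pr p q x x' y y').[t] =
    N t p x y * N t q x' y' - N t p x y' * N t q x' y.
  by rewrite /Pr hornerD hornerN !hornerM !NpE.
(* If some column minor is a nonzero polynomial in t, its product with any row minor still vanishes
   at every t, so all row minors are zero. *)
have {colrow} [hc|hr] : (forall t, col t) \/ (forall t, row t).
  have [[p [q [x [x' [y [y' n0]]]]]]|hc] := pselect (exists p q x x' y y',
      Pc p q x x' y y' != 0); last first.
    left=> t p q x x' y y'; apply/eqP; rewrite -subr_eq0 -PcE.
    have -> : Pc p q x x' y y' = 0; last by rewrite horner0.
    by apply/eqP; apply: contrapT => /negP n; apply: hc; exists p, q, x, x', y, y'.
  right=> t p1 q1 x1 x1' y1 y1'; apply/eqP; rewrite -subr_eq0 -PrE.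
  have [|E|->] := @poly_prod_eq0 (Pc p q x x' y y') (Pr p1 q1 x1 x1' y1 y1').
  - move=> t'; rewrite PcE PrE.
    by case: (colrow t') => H; [rewrite (H p q) | rewrite (H p1 q1)];
      rewrite subrr ?mul0r ?mulr0.
  - by rewrite E eqxx in n0.
  - by rewrite horner0.
- have [H|H] := @rank_one_pencil 'I_2 ('I_2 * 'I_2)%type (fun u x vy => W x vy.2 u vy.1)
    (fun t x x' y y' => etrans (hc t y.1 y'.1 x x' y.2 y'.2) (mulrC _ _)).
  + by apply: Or41 => x y u v x' y' u' v'; rewrite (H u u' x x' (v, y) (v', y')) mulrC.
  + by apply: Or42 => x y u v x' y' u' v'; rewrite (H u u' x x' (v, y) (v', y')).
- have [H|H] := @rank_one_pencil ('I_2 * 'I_2)%type 'I_2 (fun u vx y => W vx.2 y u vx.1)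
    (fun t x x' y y' => (hr t x.1 x'.1 x.2 x'.2 y y')).
  + by apply: Or43 => x y u v x' y' u' v'; rewrite (H u u' (v, x) (v', x') y y') mulrC.
  + by apply: Or44 => x y u v x' y' u' v'; rewrite (H u u' (v, x) (v', x') y y').
Qed.

End RankOne.

(** * Factorization of pure states *)

Section Factorization.
Variables (R : realType) (T : finType).
Local Notation C := R[i].
Implicit Types (A : {set T}) (x z w : ket T) (phi : 'cV[C]_(dimq T)).

Definition swapket A z w : ket T := [ffun u => if u \in A then z u else w u].

(* The 2 x 2 minors of phi across the bipartition A | ~: A vanish. *)
Definition factors_at A phi := forall z w,
  phi (kidx z) 0 * phi (kidx w) 0 =
  phi (kidx (swapket A z w)) 0 * phi (kidx (swapket A w z)) 0.

Lemma swapketK A z w : swapket A (swapket A z w) (swapket A w z) = z.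
Proof. by apply/ffunP => u; rewrite !ffunE; case: (u \in A). Qed.

Lemma restr_swapl A z w : restr A (swapket A z w) = restr A z.
Proof. by apply/ffunP => u; rewrite !ffunE (valP u). Qed.

Lemma restr_swapr A z w : restr (~: A)%SET (swapket A z w) = restr (~: A)%SET w.
Proof.
by apply/ffunP => u; rewrite !ffunE; have := valP u; rewrite inE => /negbTE ->.
Qed.

Lemma glue_swap A z w : glue (restr A z) (restr (~: A)%SET w) = swapket A z w.
Proof.
apply: (@restr_inj _ A); rewrite ?restr_glueL ?restr_glueR.
  by rewrite restr_swapl.
by rewrite restr_swapr.
Qed.

(** Vanishing minors mean rank at most one: the slices through a nonzero amplitude at [z0] are the
    factors, one of them divided by that amplitude. *)
Lemma biseparable_pureP phi : biseparable_pure phi <->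
  exists A, [/\ A != finset.set0, A != [set: T]%SET & factors_at A phi].
Proof.
split=> [[A [A0 AT [f [g fg]]]]|[A [A0 AT hA]]]; exists A; split=> //.
  by move=> z w; rewrite !fg !restr_swapl !restr_swapr; ring.
have [[z0 n0]|h0] := pselect (exists z, phi (kidx z) 0 != 0).
  exists (\col_p phi (kidx (glue (kval p) (restr (~: A)%SET z0))) 0).
  exists (\col_q (phi (kidx (glue (restr A z0) (kval q))) 0 / phi (kidx z0) 0)).
  by move=> x; rewrite !mxE !kidxK !glue_swap mulrA -hA mulfK.
exists 0, 0 => x; rewrite !mxE mulr0; apply/eqP; apply: contrapT => /negP n.
by apply: h0; exists x.
Qed.

(* Swapping the A-parts of the two summation indices turns the product of the
   diagonal entries into the product of the off-diagonal ones. *)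
Lemma det_contr_factors A s t a phi : s \in A -> t \notin A ->
  factors_at A phi -> \det (contr s t a phi) = 0.
Proof.
move=> sA tA hA.
pose W z : C := \prod_(u | u \notin [set s; t]%SET) a u (z u).
have E (x y x' y' : 'I_2) : contr s t a phi x y * contr s t a phi x' y' =
    \sum_(p : ket T * ket T | ((p.1 s == x) && (p.1 t == y)) &&
                              ((p.2 s == x') && (p.2 t == y')))
      (W p.1 * phi (kidx p.1) 0) * (W p.2 * phi (kidx p.2) 0).
  by rewrite !mxE big_distrlr pair_big.
rewrite det2 !E; apply/eqP; rewrite subr_eq0; apply/eqP.
pose h (p : ket T * ket T) := (swapket A p.1 p.2, swapket A p.2 p.1).
have hK : involutive h by case=> z w; rewrite /h /= !swapketK.
rewrite (reindex_inj (inv_inj hK)) /=; apply: eq_big => [[z w]|[z w] _] /=.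
  rewrite !ffunE sA (negbTE tA).
  by do ![case: (_ == _)].
have WW : W (swapket A z w) * W (swapket A w z) = W z * W w.
  rewrite /W -!big_split; apply: eq_bigr => u _; rewrite !ffunE /=.
  by case: (u \in A); rewrite // mulrC.
by rewrite mulrACA WW -hA mulrACA.
Qed.

(** If [t] lies in [A] instead of [s], the complement describes the same bipartition. *)
Lemma det_contr_biseparable A s t a phi : (s \in A) != (t \in A) ->
  factors_at A phi -> \det (contr s t a phi) = 0.
Proof.
have [sA|sA] := boolP (s \in A); have [tA|tA] // := boolP (t \in A) => _ hA.
  exact: det_contr_factors hA.
have E z w : swapket (~: A)%SET z w = swapket A w z.
  by apply/ffunP => u; rewrite !ffunE inE; case: (u \in A).
apply: (@det_contr_factors (~: A)%SET); rewrite ?inE ?sA ?negbK //.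
by move=> z w; rewrite !E hA mulrC.
Qed.

End Factorization.

(** * From vanishing determinants to a bipartition of four parties *)

Section FourParties.
Variables (R : realType) (T : finType) (i j k l : T).
Local Notation C := R[i].
Hypothesis ijkl : uniq [:: i; j; k; l].
Hypothesis T4 : forall x, x \in [:: i; j; k; l].
Implicit Types (phi : 'cV[C]_(dimq T)).

Definition ket4 x y u v : ket T :=
  [ffun z => if z == i then x else if z == j then y else if z == k then u else v].

Let neqs : [/\ j == i = false, k == i = false, l == i = false &
              [/\ k == j = false, l == j = false & l == k = false]].
Proof.
move: ijkl; rewrite /= !inE !negb_or => /and4P[/and3P[a b c] /andP[d e] f _].
by split; [| | | split]; apply/negbTE; rewrite eq_sym.
Qed.

Lemma ket4E x y u v : [/\ ket4 x y u v i = x, ket4 x y u v j = y,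
  ket4 x y u v k = u & ket4 x y u v l = v].
Proof.
case: neqs => ji ki li [kj lj lk].
by rewrite !ffunE !eqxx ji ki li kj lj lk.
Qed.

Lemma ket4_eta (z : ket T) : ket4 (z i) (z j) (z k) (z l) = z.
Proof.
apply/ffunP => w; case: (ket4E (z i) (z j) (z k) (z l)) => hi hj hk hl.
by have := T4 w; rewrite !inE => /or4P[] /eqP ->.
Qed.

Lemma sum_ket4 (V : nmodType) (F : ket T -> V) :
  \sum_z F z = \sum_x \sum_y \sum_u \sum_v F (ket4 x y u v).
Proof.
under [RHS]eq_bigr => x _ do under eq_bigr => y _ do rewrite pair_big /=.
under [RHS]eq_bigr => x _ do rewrite pair_big /=.
rewrite pair_big /=.
rewrite (reindex (fun p : 'I_2 * ('I_2 * ('I_2 * 'I_2)) => ket4 p.1 p.2.1 p.2.2.1 p.2.2.2)) //=.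
exists (fun z => (z i, (z j, (z k, z l)))) => [[x [y [u v]]] _|z _] /=.
  by case: (ket4E x y u v) => -> -> -> ->.
exact: ket4_eta.
Qed.

Lemma contr4 a phi x y : contr i j a phi x y =
  \sum_u \sum_v a k u * a l v * phi (kidx (ket4 x y u v)) 0.
Proof.
case: neqs => ji ki li [kj lj lk].
rewrite mxE big_mkcond sum_ket4 (bigD1 x) //= [X in _ + X]big1 ?addr0; last first.
  move=> x' /negbTE hx; rewrite big1 // => y' _; rewrite big1 // => u _.
  by rewrite big1 // => v _; case: (ket4E x' y' u v) => -> -> _ _; rewrite hx.
rewrite (bigD1 y) //= [X in _ + X]big1 ?addr0; last first.
  move=> y' /negbTE hy; rewrite big1 // => u _.
  by rewrite big1 // => v _; case: (ket4E x y' u v) => -> -> _ _; rewrite hy andbF.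
apply: eq_bigr => u _; apply: eq_bigr => v _.
have [-> -> ek el] := ket4E x y u v; rewrite !eqxx; congr (_ * _).
rewrite (bigD1 k) ?inE ?ki ?kj //= (bigD1 l) ?inE ?li ?lj ?lk //= ek el.
rewrite big1 ?mulr1 // => w; rewrite !inE negb_or => /andP[/andP[/andP[wi wj] wk] wl].
by have := T4 w; rewrite !inE (negbTE wi) (negbTE wj) (negbTE wk) (negbTE wl).
Qed.

(** The alternatives of [rank_one_bipencil] are, in order, the bipartitions i | jkl, ik | jl, il |
    jk and ikl | j. *)
Lemma biseparable_of_det phi :
  (forall a, \det (contr i j a phi) = 0) -> biseparable_pure phi.
Proof.
case: neqs => ji ki li [kj lj lk] h.
pose W x y u v := phi (kidx (ket4 x y u v)) 0.
have phiE z : phi (kidx z) 0 = W (z i) (z j) (z k) (z l) by rewrite /W ket4_eta.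
have ij : i == j = false by rewrite eq_sym.
have ik : i == k = false by rewrite eq_sym.
have il : i == l = false by rewrite eq_sym.
have jk : j == k = false by rewrite eq_sym.
have jl : j == l = false by rewrite eq_sym.
have kl : k == l = false by rewrite eq_sym.
have bis (A : {set T}) : i \in A -> j \notin A -> factors_at A phi -> biseparable_pure phi.
  move=> iA jA fA; apply/biseparable_pureP; exists A; split=> //.
    by apply: contraTneq iA => ->; rewrite inE.
  by apply: contraNneq jA => ->; rewrite inE.
have [] := @rank_one_bipencil _ W.
- move=> a b.
  pose c z := if z == k then a else b.
  have E x y : contr i j c phi x y = \sum_u \sum_v a u * b v * W x y u v.
    by rewrite contr4 /c eqxx lk.
  have := h c; rewrite det2 !E => /eqP; rewrite subr_eq0 => /eqP D.
  move: D; set m := fun x y => \sum_u \sum_v a u * b v * W x y u v.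
  rewrite -[_ * _]/(m _ _ * m _ _) -[in RHS]/(m _ _ * m _ _) => D.
  move=> x x' y y'; rewrite /= -[_ * _ = _]/(m x y * m x' y' = m x y' * m x' y).
  (* Each of the sixteen identities is trivial or is the determinant identity [D] up to
     commutation. *)
  move: x x' y y'; apply: ord2P; apply: ord2P; apply: ord2P; apply: ord2P;
    first [by [] | by rewrite mulrC | by rewrite D | by rewrite D mulrC
          | by rewrite mulrC -D mulrC | by rewrite mulrC D mulrC].
- move=> H; apply: (bis [set i]%SET); rewrite ?inE ?ji //.
  by move=> z w; rewrite !phiE !ffunE !inE eqxx ?ji ?ki ?li H.
- move=> H; apply: (bis [set i; k]%SET); rewrite ?inE ?eqxx ?ji ?jk //.
  by move=> z w; rewrite !phiE !ffunE !inE !eqxx ?ji ?ki ?li ?jk ?lk ?orbT /= H.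
- move=> H; apply: (bis [set i; l]%SET); rewrite ?inE ?eqxx ?ji ?jl //.
  by move=> z w; rewrite !phiE !ffunE !inE !eqxx ?ji ?ki ?li ?jl ?kl ?orbT /= H.
- move=> H; apply: (bis [set i; k; l]%SET); rewrite ?inE ?eqxx ?ji ?jl ?jk //.
  by move=> z w; rewrite !phiE !ffunE !inE !eqxx ?ji ?ki ?li ?jl ?jk ?kl ?lk ?orbT /= H.
Qed.

End FourParties.

(** * Three probe vectors per party *)

Section Probes.
Variable R : realType.
Local Notation C := R[i].

(** A quadratic form in two variables is determined by its values in three directions: the two axes
    and a unit vector with both coordinates nonzero, here the rational (3/5, 4/5). *)
Definition probe_cos (c : 'I_3) : R := nth 0 [:: 1; 0; 3 / 5] c.
Definition probe_sin (c : 'I_3) : R := nth 0 [:: 0; 1; 4 / 5] c.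

(** The probe vector is the row [ord0]; it is completed to a rotation because measurement vectors
    are rows of unitaries. *)
Definition probe (c : 'I_3) : 'M[C]_2 :=
  \matrix_(x, y) (if x == y then probe_cos c
                  else if x == ord0 then probe_sin c else - probe_sin c)%:C.

Lemma probe_unitary c : probe c \is unitarymx.
Proof.
apply/unitarymxP; set a : C := (probe_cos c)%:C; set b : C := (probe_sin c)%:C.
have ab : a * a + b * b = 1.
  rewrite -!rmorphM -rmorphD /= /probe_cos /probe_sin.
  by case: c {a b} => [[|[|[|//]]] hc] /=; congr (_%:C); field.
have tE x y : ((probe c)^t*) x y = probe c y x.
  by rewrite mxE [X in Num.conj X]mxE [probe c y x]mxE conjR.
have p00 : probe c ord0 ord0 = a by rewrite mxE.
have p01 : probe c ord0 ord_max = b by rewrite mxE.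
have p10 : probe c ord_max ord0 = - b by rewrite mxE /= rmorphN.
have p11 : probe c ord_max ord_max = a by rewrite mxE.
clearbody a b; apply/matrixP.
apply: ord2P; apply: ord2P; rewrite !mxE sum_ord2 !tE ?p00 ?p01 ?p10 ?p11 /=.
- by rewrite ab.
- by rewrite mulr0n; ring.
- by rewrite mulr0n; ring.
- by rewrite mulrNN addrC ab.
Qed.

Section Forms.
Variable W : 'I_2 -> 'I_2 -> 'I_2 -> 'I_2 -> C.
Let D (f g : 'I_2 -> C) : C :=
  \det (\matrix_(x, y) \sum_u \sum_v f u * g v * W x y u v).

(** [D] is a quadratic form in [f] and in [g]. Its value at (3/5, 4/5) is 9/25 and 16/25 of the axis
    values plus 12/25 of the mixed coefficient, whence the factor 25/12. *)
Lemma probes_det :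
  (forall p q, D (probe p ord0) (probe q ord0) = 0) -> forall f g, D f g = 0.
Proof.
move=> h.
have five : (5 : C) != 0 by rewrite pnatr_eq0.
pose p0 : 'I_3 := ord0; pose p1 : 'I_3 := lift ord0 ord0; pose p2 : 'I_3 := ord_max.
have P p : probe p ord0 = fun u => if u == ord0 then (probe_cos p)%:C else (probe_sin p)%:C.
  by apply: funext; apply: ord2P; rewrite mxE.
have c2 : (3 / 5)%:C = 3 / 5 :> C by rewrite rmorphM fmorphV !rmorph_nat.
have s2 : (4 / 5)%:C = 4 / 5 :> C by rewrite rmorphM fmorphV !rmorph_nat.
have Dl f g : D f g = f ord0 ^+ 2 * D (probe p0 ord0) g + f ord_max ^+ 2 * D (probe p1 ord0) g
    + f ord0 * f ord_max * (25 / 12) * (D (probe p2 ord0) g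
      - 9 / 25 * D (probe p0 ord0) g - 16 / 25 * D (probe p1 ord0) g).
  rewrite /D !det2 !mxE !sum_ord2 !P /= /probe_cos /probe_sin /= ?c2 ?s2 !rmorph0 !rmorph1.
  by field.
have Dr f g : D f g = g ord0 ^+ 2 * D f (probe p0 ord0) + g ord_max ^+ 2 * D f (probe p1 ord0)
    + g ord0 * g ord_max * (25 / 12) * (D f (probe p2 ord0)
      - 9 / 25 * D f (probe p0 ord0) - 16 / 25 * D f (probe p1 ord0)).
  rewrite /D !det2 !mxE !sum_ord2 !P /= /probe_cos /probe_sin /= ?c2 ?s2 !rmorph0 !rmorph1.
  by field.
have h1 p g : D (probe p ord0) g = 0 by rewrite Dr !h; ring.
by move=> f g; rewrite Dl !h1; ring.
Qed.

End Forms.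
End Probes.

(** * The pairwise quantities on pure states *)

(** Measuring [K] first and contracting the rest afterwards is one contraction with a product
    vector; this ties the barred quantities to the same determinants. *)
Lemma contr_bra (R : realType) (T : finType) (K : {set T})
    (U : sub K -> 'M[R[i]]_2) (J : ket (sub K)) (s t : sub (~: K)%SET) b a
    (phi : 'cV[R[i]]_(dimq T)) :
  (forall u, a (val u) = U u (J u)) -> (forall u, a (val u) = b u) ->
  contr s t b (bra_op U J *m phi) = contr (val s) (val t) a phi.
Proof.
move=> aU ab; apply/matrixP => x y; rewrite [LHS]mxE [RHS]mxE [LHS]big_mkcond /=.
transitivity (\sum_c \sum_(z | restr (~: K)%SET z == c)
   if (c s == x) && (c t == y) then
   (\prod_(u | u \notin [set s; t]%SET) b u (c u)) *
   ((\prod_u U u (J u) (z (val u))) * phi (kidx z) 0) else 0).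
  apply: eq_bigr => c _; rewrite bra_op_apply; case: ifP => _.
    by rewrite big_distrr.
  by rewrite big1.
rewrite sum_fiber [RHS]big_mkcond; apply: eq_bigr => z _; rewrite !ffunE.
case: ifP => // _; rewrite mulrA; congr (_ * _).
rewrite [RHS]big_mkcond (prod_glue K) /= mulrC; congr (_ * _).
  apply: eq_bigr => u _; have uK : val u \in K := valP u; rewrite ifT ?aU //.
  have sK : val s \notin K by have := valP s; rewrite inE.
  have tK : val t \notin K by have := valP t; rewrite inE.
  have us : val u != val s by apply: contraNneq sK => <-.
  have ut : val u != val t by apply: contraNneq tK => <-.
  by rewrite !inE negb_or; apply/andP.
rewrite [LHS]big_mkcond; apply: eq_bigr => u _.
by rewrite !inE -!val_eqE ffunE ab.
Qed.

Lemma ord4_complete (i j : 'I_4) : i != j ->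
  exists k l, uniq [:: i; j; k; l] /\ forall x, x \in [:: i; j; k; l].
Proof.
move=> ij; have : #|~: [set i; j]%SET| == 2.
  by rewrite -(eqn_add2l #|[set i; j]%SET|) cardsC cards2 ij card_ord.
move=> /cards2P[k [l [kl E]]]; exists k, l.
have ink x : (x \in ~: [set i; j]%SET) = (x == k) || (x == l) by rewrite E !inE.
have := ink k; have := ink l; rewrite !inE !eqxx orbT /= !negb_or.
move=> /andP[li lj] /andP[ki kj]; split.
  by rewrite /= ij (eq_sym i k) (eq_sym i l) (eq_sym j k) (eq_sym j l) ki kj li lj kl.
move=> x; have := ink x; rewrite !inE negb_or.
by case: (x == i); case: (x == j) => //= <-.
Qed.

Section PairMeasures.
Variable R : realType.
Local Notation C := R[i].
Local Notation state := 'cV[C]_(dimq 'I_4).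

(** The interface shared by [T4] and [Tbar4]. Together with the lower bound 0, the third clause
    forces the value 0. *)
Definition pair_measure (t : 'I_4 -> 'I_4 -> state -> R) :=
  forall i j, i != j -> forall psi, unit_vector psi ->
  [/\ 0 <= t i j psi <= 1,
      forall c : {ffun 'I_4 -> 'I_3},
        2 * nc (\det (contr i j (fun u => probe R (c u) ord0) psi)) <= t i j psi,
      (forall a, \det (contr i j a psi) = 0) -> t i j psi <= 0 &
      forall V : 'I_4 -> 'M[C]_2, (forall u, V u \is unitarymx) ->
        t i j (tens_op V *m psi) = t i j psi].

Lemma T4_pair_measure : pair_measure (@T4 R).
Proof.
move=> i j ij psi /unit_nrm2 psi1; rewrite /T4 /F4 /f4.
have TE (x : R) : 3 * ((2 * x + 1) / 3) - 2 = 2 * x - 1 by field.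
split.
- have := fpair_ge_half ij psi; have := fpair_le_nrm2 ij psi.
  by rewrite psi1 TE => h1 h2; apply/andP; split; lra.
- move=> c; have := fpair_ge_contr ij psi (fun _ => ord0) (fun u => probe_unitary R (c u)).
  by rewrite psi1 TE; lra.
- by move=> h; have := fpair_le_half ij h; rewrite psi1 TE; lra.
- by move=> V hV; rewrite (fpair_tens ij _ hV).
Qed.

(** * Measuring one party first and adapting the next basis *)

Section Adaptive.
Variables (i j k : 'I_4).
Hypotheses (ij : i != j) (kij : k \notin [set i; j]%SET).
Local Notation Q := (sub (~: [set k])%SET).

Let hi : i \in (~: [set k])%SET.
Proof. by move: kij; rewrite !inE negb_or eq_sym => /andP[]. Qed.
Let hj : j \in (~: [set k])%SET.
Proof. by move: kij; rewrite !inE negb_or (eq_sym k j) => /andP[]. Qed.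
Let i' : Q := exist _ i hi.
Let j' : Q := exist _ j hj.
Let ij' : i' != j'. Proof. exact: ij. Qed.

Let ijE : [set x : Q | val x \in [set i; j]%SET]%SET = [set i'; j']%SET.
Proof. by apply/setP => x; rewrite !inE. Qed.

Definition meas_k (U : 'M[C]_2) (t : 'I_2) : 'M[C]_(dimq Q, dimq 'I_4) :=
  bra_op (fun _ : sub [set k]%SET => U) [ffun=> t].

Definition adaptive_value (U : 'M[C]_2) (psi : state) : R :=
  \sum_(t < 2) fpair [set i'; j']%SET (proj_of (meas_k U t *m psi)).

Lemma fbar4_at_proj (psi : state) :
  fbar4_at i j k (proj_of psi) = sup [set v | exists2 U : 'M[C]_2,
    U \is unitarymx & v = adaptive_value U psi]%classic.
Proof.
rewrite /fbar4_at ijE; apply: f_equal; apply/seteqP.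
split=> v [U hU ->]; exists U => //; apply: eq_bigr => t _;
rewrite /post_state prob_proj proj_of_mul weighted_post // => c w;
exact: fpair_scale.
Qed.

Lemma sum_nrm2_meas U psi : U \is unitarymx ->
  \sum_(t < 2) nrm2 (meas_k U t *m psi) = nrm2 psi.
Proof.
move=> hU; rewrite -(sum_nrm2_bra psi (fun _ : sub [set k]%SET => hU)).
symmetry; rewrite (reindex (fun t : 'I_2 => [ffun=> t] : ket (sub [set k]%SET))) //.
exists (fun J : ket (sub [set k]%SET) => J (exist _ k (finset.set11 k))) => [t _|J _]; first by rewrite ffunE.
apply/ffunP => -[x hx]; rewrite ffunE.
have xk := hx; move: xk; rewrite finset.in_set1 => /eqP xk; subst x.
by congr (J _); apply: val_inj.
Qed.

Lemma adaptive_le U psi : U \is unitarymx -> adaptive_value U psi <= nrm2 psi.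
Proof.
move=> hU; rewrite -(sum_nrm2_meas psi hU); apply: ler_sum => t _.
exact: fpair_le_nrm2.
Qed.

Lemma fbar4_at_le (psi : state) : fbar4_at i j k (proj_of psi) <= nrm2 psi.
Proof.
rewrite fbar4_at_proj; apply: (@supD_le _ _ _ _ _ 1%:M); first exact: unitary1.
by move=> U hU; exact: adaptive_le.
Qed.

(** Outcome [ord0] at [k] contributes its half norm and the determinant, outcome [ord_max] just its
    half norm. *)
Lemma fbar4_at_ge (psi : state) (U : 'I_4 -> 'M[C]_2) :
  (forall u, U u \is unitarymx) ->
  nrm2 psi / 2 + nc (\det (contr i j (fun u => U u ord0) psi)) <=
  fbar4_at i j k (proj_of psi).
Proof.
move=> hU; rewrite fbar4_at_proj.
apply: (@le_trans _ _ (adaptive_value (U k) psi)); last first.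
  by apply: (@le_supD _ _ _ (adaptive_value^~ psi) (nrm2 psi)) => // V hV; exact: adaptive_le.
rewrite /adaptive_value sum_ord2 -(sum_nrm2_meas psi (hU k)) sum_ord2 mulrDl.
have h0 := fpair_ge_contr ij' (meas_k (U k) ord0 *m psi) (fun _ => ord0)
  (fun u => hU (val u)).
have h1 := fpair_ge_half ij' (meas_k (U k) ord_max *m psi).
have cE : contr i' j' (fun u => U (val u) ord0) (meas_k (U k) ord0 *m psi) =
    contr i j (fun u => U u ord0) psi.
  apply: contr_bra => // u.
  by rewrite ffunE; have := valP u; rewrite finset.in_set1 => /eqP ->.
rewrite cE in h0; apply: le_trans (lerD h0 h1); rewrite addrAC; exact: lexx.
Qed.

Lemma fbar4_at_half (psi : state) : (forall a, \det (contr i j a psi) = 0) ->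
  fbar4_at i j k (proj_of psi) <= nrm2 psi / 2.
Proof.
move=> h; rewrite fbar4_at_proj; apply: (@supD_le _ _ _ _ _ 1%:M).
  exact: unitary1.
move=> U hU; rewrite -(sum_nrm2_meas psi hU) mulr_suml; apply: ler_sum => t _.
apply: fpair_le_half => // a.
(* [b] is the measured row at [k] and agrees with [a] elsewhere. *)
pose b u := if insub u : option Q is Some v then a v else U t.
rewrite (@contr_bra _ _ _ _ _ _ _ _ b) // => u.
  by rewrite /b ffunE insubF //; have := valP u; rewrite !inE => ->.
by rewrite /b valK.
Qed.

Lemma fbar4_at_tens (psi : state) (V : 'I_4 -> 'M[C]_2) :
  (forall u, V u \is unitarymx) ->
  fbar4_at i j k (proj_of (tens_op V *m psi)) = fbar4_at i j k (proj_of psi).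
Proof.
move=> hV; rewrite !fbar4_at_proj.
have valV U : adaptive_value U (tens_op V *m psi) = adaptive_value (U *m V k) psi.
  have E : (fun u : sub [set k]%SET => U *m V (val u)) = fun _ => U *m V k.
    by apply: funext => u; have := valP u; rewrite finset.in_set1 => /eqP ->.
  apply: eq_bigr => t _; rewrite /meas_k mulmxA bra_op_tens E -mulmxA.
  exact: (fpair_tens ij' _ (fun u => hV (val u))).
apply: f_equal; apply/seteqP; split=> v [U hU ->].
  by exists (U *m V k); rewrite ?mul_unitarymx.
exists (U *m (V k)^t*); first by rewrite mul_unitarymx ?trmxC_unitary.
by rewrite valV mulmxKtV.
Qed.

End Adaptive.

(** Lower bounds use one choice of the first measured party, upper bounds hold for every choice. *)
Lemma Tbar4_pair_measure : pair_measure (@Tbar4 R).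
Proof.
move=> i j ij psi hpsi; have /unit_nrm2 psi1 := hpsi; rewrite /Tbar4 /Fbar4.
have TE (x : R) : 3 * ((2 * x + 1) / 3) - 2 = 2 * x - 1 by field.
have [k [l [ijkl _]]] := ord4_complete ij.
have kij : k \notin [set i; j]%SET.
  move: ijkl; rewrite /= !inE !negb_or => /and4P[/and3P[_ ik _] /andP[jk _] _ _].
  by rewrite ![k == _]eq_sym ik jk.
have fE (phi : state) : fbar4 i j (proj_of phi) = sup [set v | exists2 k, k \notin
    [set i; j]%SET & v = fbar4_at i j k (proj_of phi)]%classic by [].
have atk (c : R) : c <= fbar4_at i j k (proj_of psi) -> c <= fbar4 i j (proj_of psi).
  move=> h; apply: (le_trans h); rewrite fE.
  apply: (@le_supD _ _ _ (fun k => fbar4_at i j k (proj_of psi)) (nrm2 psi)) => // k' hk'.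
  exact: fbar4_at_le.
have lek (c : R) : (forall k, k \notin [set i; j]%SET -> fbar4_at i j k (proj_of psi) <= c) ->
    fbar4 i j (proj_of psi) <= c.
  by move=> h; rewrite fE; apply: (@supD_le _ _ _ (fun k => fbar4_at i j k (proj_of psi)) c _ kij).
split.
- have h1 : fbar4 i j (proj_of psi) <= 1.
    by apply: lek => k' hk'; rewrite -psi1; exact: fbar4_at_le.
  have h2 : 2^-1 <= fbar4 i j (proj_of psi).
    apply: atk; have := @fbar4_at_ge i j k ij kij psi (fun _ => 1%:M) (fun _ => unitary1 _ _).
    by rewrite psi1; apply: le_trans; rewrite mul1r lerDl nc_ge0.
  by rewrite TE; apply/andP; split; lra.
- move=> c; set n := nc _; rewrite TE.
  have : 2^-1 + n <= fbar4 i j (proj_of psi).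
    apply: atk; have := @fbar4_at_ge i j k ij kij psi _ (fun u => probe_unitary R (c u)).
    by rewrite psi1 mul1r.
  by lra.
- move=> h; rewrite TE; have : fbar4 i j (proj_of psi) <= 2^-1; last by lra.
  apply: lek => k' hk'; have := fbar4_at_half ij hk' h.
  by rewrite psi1 mul1r.
- move=> V hV.
  suff -> : fbar4 i j (proj_of (tens_op V *m psi)) = fbar4 i j (proj_of psi) by [].
  rewrite !fE; apply: f_equal.
  apply/seteqP; split=> v [k' hk' ->]; exists k'; try exact: hk'.
    exact: (fbar4_at_tens ij hk' psi hV).
  exact: (esym (fbar4_at_tens ij hk' psi hV)).
Qed.

End PairMeasures.

(** * Decompositions into pure states *)

Section Decompositions.
Variables (R : realType) (n : nat).
Local Notation C := R[i].
Local Notation d := (n * n + n * n)%N.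
Implicit Types (rho : 'M[C]_n) (G : 'cV[C]_n -> R).

Lemma Im_mulR (r : R) (z : C) : complex.Im (r%:C * z) = r * complex.Im z.
Proof. by case: z => a b /=; rewrite mul0r addr0. Qed.

Lemma Im_sum (I : finType) (P : pred I) (F : I -> C) :
  complex.Im (\sum_(i | P i) F i) = \sum_(i | P i) complex.Im (F i).
Proof. by apply: (big_morph (@complex.Im R)) => [[a b] [a' b']|]. Qed.

Lemma complexP (z w : C) : complex.Re z = complex.Re w ->
  complex.Im z = complex.Im w -> z = w.
Proof. by case: z w => a b [a' b'] /= -> ->. Qed.

Lemma decomposition_drop m (p : 'I_m.+1 -> R) psi rho (l0 : 'I_m.+1) G :
  decomposition p psi rho -> p l0 = 0 ->
  decomposition (fun l => p (lift l0 l)) (fun l => psi (lift l0 l)) rho /\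
  \sum_l p (lift l0 l) * G (psi (lift l0 l)) = \sum_l p l * G (psi l).
Proof.
move=> [p0 p1 u e] z; split; last by rewrite [RHS](bigD1_ord l0) //= z mul0r add0r.
split=> //; first by rewrite -p1 [RHS](bigD1_ord l0) //= z add0r.
by rewrite e [LHS](bigD1_ord l0) //= z scale0r add0r.
Qed.

Lemma decomposition_pad m (p : 'I_m -> R) psi rho G :
  decomposition p psi rho ->
  exists (p' : 'I_m.+1 -> R) psi', decomposition p' psi' rho /\
    \sum_l p' l * G (psi' l) = \sum_l p l * G (psi l).
Proof.
(* The added weight is 0, but its vector must still be a unit vector, so an existing one is
   repeated; weights summing to 1 guarantee that there is one. *)
move=> [p0 p1 u e]; have [l1 _] : exists l : 'I_m, true.
  case: m p psi p0 p1 u e => [|m] p psi p0 p1 u e; last by exists ord0.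
  by move: p1; rewrite big_ord0 => /eqP; rewrite eq_sym oner_eq0.
pose p' (l : 'I_m.+1) := if unlift ord0 l is Some l' then p l' else 0.
pose psi' (l : 'I_m.+1) := if unlift ord0 l is Some l' then psi l' else psi l1.
have p'0 : p' ord0 = 0 by rewrite /p' unlift_none.
have p'S l : p' (lift ord0 l) = p l by rewrite /p' liftK.
have psi'S l : psi' (lift ord0 l) = psi l by rewrite /psi' liftK.
exists p', psi'; split; last first.
  rewrite big_ord_recl p'0 mul0r add0r.
  by apply: eq_bigr => l _; rewrite p'S psi'S.
split.
- by move=> l; rewrite /p'; case: unlift.
- by rewrite big_ord_recl p'0 add0r -p1; apply: eq_bigr => l _; rewrite p'S.
- by move=> l; rewrite /psi'; case: unlift.
rewrite e big_ord_recl p'0 scale0r add0r.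
by apply: eq_bigr => l _; rewrite p'S psi'S.
Qed.

(* Moving the weights along a linear relation between the projectors, in the
   direction that does not increase the value, makes one weight vanish. *)
Lemma decomposition_reduce m (p : 'I_m.+1 -> R) psi rho G : (d < m.+1)%N ->
  decomposition p psi rho ->
  exists (p' : 'I_m -> R) psi', decomposition p' psi' rho /\
    \sum_l p' l * G (psi' l) <= \sum_l p l * G (psi l).
Proof.
move=> dm [p0 p1 u e].
(* Rows list real and imaginary parts, whence [d = n * n + n * n] real coordinates; more than [d]
   rows are linearly dependent. *)
pose V : 'M[R]_(m.+1, d) := \matrix_(l, q)
  row_mx (mxvec (map_mx (@complex.Re R) (proj_of (psi l))))
         (mxvec (map_mx (@complex.Im R) (proj_of (psi l)))) 0 q.
have [c cV c0] : exists2 c : 'rV[R]_m.+1, c *m V = 0 & c != 0.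
  have : kermx V != 0.
    rewrite -mxrank_eq0 mxrank_ker -lt0n subn_gt0.
    exact: leq_ltn_trans (rank_leq_col V) dm.
  by move=> /rowV0Pn[c /sub_kermxP cV c0]; exists c.
have rel : \sum_l (c 0 l)%:C *: proj_of (psi l) = 0.
  apply/matrixP => a b; rewrite summxE mxE; apply: complexP.
    rewrite Re_sum; move/matrixP: cV => /(_ 0 (lshift _ (mxvec_index a b))).
    rewrite mxE [RHS]mxE => h; apply: (etrans _ h); apply: eq_bigr => l _.
    by rewrite [in LHS]mxE Re_mulR [V _ _]mxE row_mxEl mxvecE [in RHS]mxE.
  rewrite Im_sum; move/matrixP: cV => /(_ 0 (rshift _ (mxvec_index a b))).
  rewrite mxE [RHS]mxE => h; apply: (etrans _ h); apply: eq_bigr => l _.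
  by rewrite [in LHS]mxE Im_mulR [V _ _]mxE row_mxEr mxvecE [in RHS]mxE.
(* Every projector has trace 1, so the trace of the relation shows that the total weight is
   preserved. *)
have sum0 : \sum_l c 0 l = 0.
  apply: complexI; have := congr1 mxtrace rel; rewrite linear0 => h.
  apply: (etrans _ h); rewrite rmorph_sum linear_sum; apply: eq_bigr => l _ /=.
  by rewrite linearZ /= tr_proj (iffLR (unit_nrm2 _) (u l)) mulr1.
have {c cV c0 rel sum0} [c [[l2 c0] rel sum0 val0]] : exists c : 'I_m.+1 -> R,
    [/\ exists l, c l != 0, \sum_l (c l)%:C *: proj_of (psi l) = 0, \sum_l c l = 0 &
        \sum_l c l * G (psi l) <= 0].
  have nz : exists l, c 0 l != 0.
    by move: c0 => /matrix0Pn[a [l]]; rewrite ord1; exists l.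
  have [v0|v0] := leP (\sum_l c 0 l * G (psi l)) 0; first by exists (c 0).
  exists (fun l => - c 0 l); split.
  - by have [l hl] := nz; exists l; rewrite oppr_eq0.
  - under eq_bigr do rewrite rmorphN scaleNr.
    by rewrite sumrN rel oppr0.
  - by rewrite sumrN sum0 oppr0.
  - under eq_bigr do rewrite mulNr.
    by rewrite sumrN oppr_le0 ltW.
have [l1 cl1] : exists l, c l < 0.
  apply: contrapT => h; move: c0; apply/negP; rewrite negbK; apply/eqP.
  apply: (@psumr_eq0P _ _ xpredT c) => // l _.
  by rewrite leNgt; apply/negP => hl; apply: h; exists l.
pose q l := p l / - c l.
(* The smallest ratio is the longest step that keeps all weights nonnegative; it annihilates the
   weight at [l0]. *)
have [l0 cl0 lmin] : exists2 l0, c l0 < 0 & forall l, c l < 0 -> q l0 <= q l.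
  by case: (@arg_minP _ _ _ l1 (fun l => c l < 0) q cl1) => l0 ? ?; exists l0.
have q0 : 0 <= q l0 by rewrite divr_ge0 // oppr_ge0 ltW.
pose p' l := p l + q l0 * c l.
have p'_l0 : p' l0 = 0.
  by rewrite /p' /q; field; rewrite lt_eqF.
have dec : decomposition p' psi rho.
  split=> //.
  - move=> l; rewrite /p'; have [cl|cl] := leP 0 (c l).
      by rewrite addr_ge0 // mulr_ge0.
    have := lmin l cl; rewrite /q ler_pdivlMr ?oppr_gt0 // mulrN.
    by rewrite -subr_ge0 opprK addrC.
  - by rewrite big_split /= -mulr_sumr sum0 mulr0 addr0.
  - under eq_bigr do rewrite rmorphD rmorphM scalerDl -scalerA.
    by rewrite big_split /= -scaler_sumr rel scaler0 addr0.
have [dec' val'] := decomposition_drop G dec p'_l0.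
exists (fun l => p' (lift l0 l)), (fun l => psi (lift l0 l)); split=> //.
rewrite val' /p'; under eq_bigr do rewrite mulrDl -mulrA.
rewrite big_split /= -mulr_sumr gerDl.
by rewrite mulr_ge0_le0.
Qed.

(** Long decompositions are shortened and short ones padded, because the parameter space of the
    compactness argument has fixed length [d]. *)
Lemma decomposition_caratheodory m (p : 'I_m -> R) psi rho G :
  decomposition p psi rho ->
  exists (p' : 'I_d -> R) psi', decomposition p' psi' rho /\
    \sum_l p' l * G (psi' l) <= \sum_l p l * G (psi l).
Proof.
elim: m p psi => [|m IH] p psi dec.
  by case: dec => _ /eqP; rewrite big_ord0 eq_sym oner_eq0.
have [md|dm] := leqP m.+1 d; last first.
  have [p1 [psi1 [dec1 v1]]] := decomposition_reduce G dm dec.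
  have [p2 [psi2 [dec2 v2]]] := IH _ _ dec1.
  by exists p2, psi2; split=> //; apply: le_trans v1.
clear IH; rewrite -(subnKC md).
elim: (d - m.+1)%N => [|k [p1 [psi1 [dec1 v1]]]]; first by rewrite addn0; exists p, psi.
rewrite addnS; have [p2 [psi2 [dec2 v2]]] := decomposition_pad G dec1.
by exists p2, psi2; rewrite v2.
Qed.

(** Polarization: testing on [e a + z *: e b] with z = 1 and z = i gives two equations that force
    [H a b = 0]. *)
Lemma form_eq0 (H : 'M[C]_n) :
  (forall v : 'cV[C]_n, (v^t* *m H *m v) 0 0 = 0) -> H = 0.
Proof.
move=> h; apply/matrixP => a b; rewrite [RHS]mxE.
pose q (u v : 'cV[C]_n) := (u^t* *m H *m v) 0 0.
pose e a : 'cV[C]_n := delta_mx a 0.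
have qe a' b' : q (e a') (e b') = H a' b'.
  by rewrite /q /e trmx_delta map_delta_mx -mulmxA -colE -rowE !mxE.
have qD z : q (e a + z *: e b) (e a + z *: e b) =
    q (e a) (e a) + z * q (e a) (e b) + ((z^*)%R * q (e b) (e a) +
     (z^*)%R * z * q (e b) (e b)).
  have J : (e a + z *: e b)^t* = (e a)^t* + (z^*)%R *: (e b)^t*.
    by apply/matrixP => i j; rewrite !mxE rmorphD rmorphM.
  rewrite /q J !mulmxDl !mulmxDr -!scalemxAl -!scalemxAr.
  rewrite scalerA [LHS]mxE; congr (_ + _); rewrite [LHS]mxE; congr (_ + _);
    by rewrite [LHS]mxE.
have E z : z * H a b + (z^*)%R * H b a = 0.
  have h' v : q v v = 0 by exact: h.
  by have := qD z; rewrite h' (h' (e a)) (h' (e b)) !qe mulr0 addr0 add0r => <-.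
have E1 := E 1; have Ei := E 'i%C.
have i1 : (('i%C : C)^*)%R = - 'i%C by rewrite -[LHS]/(conjc _) /=; apply/eqP; rewrite eq_complex /= oppr0 !eqxx.
have ii : 'i%C * 'i%C = -1 :> C by rewrite -expr2 sqr_i.
rewrite conjC1 !mul1r in E1; rewrite i1 in Ei.
have two : (2 : C) != 0 by rewrite pnatr_eq0.
apply: (mulfI two); rewrite mulr0.
have -> : 2 * H a b = (H a b + H b a) - 'i%C * ('i%C * H a b + - 'i%C * H b a).
  by rewrite mulrDr !mulrA mulrN ii; ring.
by rewrite E1 Ei mulr0 subr0.
Qed.

Lemma density_hermitian rho : density rho -> rho^t* = rho.
Proof.
move=> [pos _]; apply/esym/eqP; rewrite -subr_eq0; apply/eqP/form_eq0 => v.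
rewrite mulmxBr mulmxBl mxE [X in _ + X]mxE.
have -> : v^t* *m rho^t* *m v = (v^t* *m rho *m v)^t*.
  by rewrite !trmx_mul !map_mxM trmxCK mulmxA.
rewrite [X in _ - X]mxE [X in Num.conj X]mxE.
have /CrealP -> : (v^t* *m rho *m v) 0 0 \is Num.real by exact: ger0_real.
exact: subrr.
Qed.

(** The spectral decomposition; it makes the set under the infimum of the roof nonempty. *)
Lemma density_decomposition rho : density rho ->
  exists p psi, @decomposition R n n p psi rho.
Proof.
move=> hrho; have herm := density_hermitian hrho; case: hrho => pos tr1.
have /orthomx_spectralP spec : rho \is normalmx by apply/normalmxP; rewrite herm.
have hP := spectral_unitarymx rho.
set P := spectralmx rho in spec hP; set D := spectral_diag rho in spec.
rewrite invmx_unitary // in spec.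
have PP : P *m P^t* = 1%:M by apply/unitarymxP.
pose psi l := col l (P^t*).
have psiJ l : (psi l)^t* = row l P.
  by apply/matrixP => a b; rewrite !mxE conjCK.
have Dl l : D 0 l = ((psi l)^t* *m rho *m psi l) 0 0.
  have : (P *m rho *m P^t*) l l = D 0 l.
    by rewrite spec !mulmxA PP mul1mx -mulmxA PP mulmx1 mxE eqxx mulr1n.
  move=> <-; rewrite psiJ -row_mul /psi colE mulmxA -row_mul -colE !mxE //.
have D0 l : 0 <= D 0 l by rewrite Dl.
have DR l : D 0 l = (complex.Re (D 0 l))%:C by rewrite RRe_real // ger0_real.
exists (fun l => complex.Re (D 0 l)), psi; split.
- by move=> l; have := D0 l; rewrite {1}DR ler0c.
- apply: complexI; rewrite rmorph_sum; apply: (etrans _ tr1).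
  rewrite spec mxtrace_mulC mulmxA PP mul1mx.
  by rewrite mxtrace_diag; apply: eq_bigr => l _; exact: esym (DR l).
- move=> l; have h : (P *m P^t*) l l = 1 by rewrite PP mxE eqxx.
  rewrite /unit_vector psiJ -[RHS]h [LHS]mxE [RHS]mxE; apply: eq_bigr => a _.
  by rewrite !mxE.
apply/matrixP => a b; rewrite {1}spec -mulmxA mxE summxE; apply: eq_bigr => l _.
by rewrite mul_diag_mx [RHS]mxE proj_ofE -DR !mxE conjCK; ring.
Qed.

End Decompositions.

(** * Compactness *)

Section ComplexContinuity.
Variables (R : realType) (X : topologicalType).
Local Notation C := R[i].
Implicit Types (f g : X -> R) (h k : X -> C).

Lemma contD f g : continuous f -> continuous g -> continuous (fun x => f x + g x).
Proof. by move=> hf hg x; apply: cvgD; [exact: hf | exact: hg]. Qed.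

Lemma contM f g : continuous f -> continuous g -> continuous (fun x => f x * g x).
Proof. by move=> hf hg x; apply: cvgM; [exact: hf | exact: hg]. Qed.

Lemma cont_const (c : R) : continuous (fun _ : X => c).
Proof. by move=> x; exact: cvg_cst. Qed.

Lemma contN f : continuous f -> continuous (fun x => - f x).
Proof. by move=> hf x; apply: cvgN; exact: hf. Qed.

Lemma cont_big (op : R -> R -> R) (e : R) (I : Type) (s : seq I) (P : pred I)
    (F : I -> X -> R) :
  (forall f g, continuous f -> continuous g -> continuous (fun x => op (f x) (g x))) ->
  (forall i, continuous (F i)) ->
  continuous (fun x => \big[op/e]_(i <- s | P i) F i x).
Proof.
move=> hop hF; elim: s => [|i s IH].
  by under eq_fun do rewrite big_nil; exact: cont_const.
under eq_fun do rewrite big_cons.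
by case: (P i) => //; exact: hop.
Qed.

(** Continuity by real and imaginary parts, so that only the topology of [R] enters. *)
Definition ccont h := continuous (fun x => complex.Re (h x)) /\
                      continuous (fun x => complex.Im (h x)).

Lemma ccontD h k : ccont h -> ccont k -> ccont (fun x => h x + k x).
Proof.
move=> [h1 h2] [k1 k2]; split.
  have -> : (fun x => complex.Re (h x + k x)) =
    (fun x => complex.Re (h x) + complex.Re (k x)).
    by apply: funext => x; case: (h x) (k x) => ? ? [].
  exact: contD.
have -> : (fun x => complex.Im (h x + k x)) =
  (fun x => complex.Im (h x) + complex.Im (k x)).
  by apply: funext => x; case: (h x) (k x) => ? ? [].
exact: contD.
Qed.

Lemma ccontM h k : ccont h -> ccont k -> ccont (fun x => h x * k x).
Proof.
move=> [h1 h2] [k1 k2]; split.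
  have -> : (fun x => complex.Re (h x * k x)) = (fun x =>
    complex.Re (h x) * complex.Re (k x) + - (complex.Im (h x) * complex.Im (k x))).
    by apply: funext => x; case: (h x) (k x) => ? ? [].
  by apply: contD; [exact: contM | apply: contN; exact: contM].
have -> : (fun x => complex.Im (h x * k x)) = (fun x =>
  complex.Re (h x) * complex.Im (k x) + complex.Im (h x) * complex.Re (k x)).
  by apply: funext => x; case: (h x) (k x) => ? ? [].
by apply: contD; exact: contM.
Qed.

Lemma ccont_const (c : C) : ccont (fun _ => c).
Proof. by split; exact: cont_const. Qed.

Lemma ccont_real f : continuous f -> ccont (fun x => (f x)%:C).
Proof. by move=> hf; split=> //=; exact: cont_const. Qed.

Lemma ccontJ h : ccont h -> ccont (fun x => ((h x)^*)%R).
Proof.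
move=> [h1 h2]; split.
  have -> // : (fun x => complex.Re ((h x)^*)%R) = (fun x => complex.Re (h x)).
  by apply: funext => x; rewrite -[((h x)^*)%R]/(conjc (h x)); case: (h x).
have -> : (fun x => complex.Im ((h x)^*)%R) = (fun x => - complex.Im (h x)).
  by apply: funext => x; rewrite -[((h x)^*)%R]/(conjc (h x)); case: (h x).
exact: contN.
Qed.

Lemma ccont_sum (I : Type) (s : seq I) (P : pred I) (F : I -> X -> C) :
  (forall i, ccont (F i)) -> ccont (fun x => \sum_(i <- s | P i) F i x).
Proof.
move=> hF; elim: s => [|i s IH].
  have -> : (fun x => \sum_(i <- [::] | P i) F i x) = fun _ => 0.
    by apply: funext => x; rewrite big_nil.
  exact: ccont_const.
have -> : (fun x => \sum_(j <- i :: s | P j) F j x) =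
    (fun x => if P i then F i x + \sum_(j <- s | P j) F j x
              else \sum_(j <- s | P j) F j x).
  by apply: funext => x; rewrite big_cons.
by case: (P i) => //; exact: ccontD.
Qed.

Lemma cont_nc2 h : ccont h -> continuous (fun x => nc (h x) ^+ 2).
Proof.
move=> [h1 h2].
have -> : (fun x => nc (h x) ^+ 2) = (fun x =>
    complex.Re (h x) * complex.Re (h x) + complex.Im (h x) * complex.Im (h x)).
  by apply: funext => x; rewrite nc_sqrE.
by apply: contD; exact: contM.
Qed.

End ComplexContinuity.

(** * A uniform lower bound over all decompositions *)

Section RoofBound.
Variables (R : realType) (n : nat).
Local Notation C := R[i].
Local Notation d := (n * n + n * n)%N.
Local Notation idx := ('I_d * option ('I_n * bool))%type.
Local Notation param := ('rV[R]_(#|{: idx}|)).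

(** A decomposition is flattened into one real row vector: [None] indexes the weight, [true] and
    [false] the real and imaginary parts of an amplitude. *)
Let coord (q : idx) (x : param) : R := x ord0 (enum_rank q).
Let weight (x : param) (l : 'I_d) : R := coord (l, None) x.
Let vect (x : param) (l : 'I_d) : 'cV[C]_n :=
  \col_a (coord (l, Some (a, true)) x +i* coord (l, Some (a, false)) x).

Let coord_cont q : continuous (coord q).
Proof. exact: coord_continuous. Qed.

Let vect_cont l a : ccont (fun x => vect x l a 0).
Proof.
have -> : (fun x => vect x l a 0) = (fun x =>
    coord (l, Some (a, true)) x +i* coord (l, Some (a, false)) x).
  by apply: funext => x; rewrite mxE.
by split; exact: coord_cont.
Qed.

(** Continuity is tested along coordinatewise continuous families, which avoids putting a topology
    on complex columns. *)
Definition continuous_on_states (G : 'cV[C]_n -> R) :=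
  forall (X : topologicalType) (f : X -> 'cV[C]_n),
    (forall a, ccont (fun x => f x a 0)) -> continuous (fun x => G (f x)).

Lemma nrm2_continuous : continuous_on_states (@nrm2 R n).
Proof.
move=> X f hf; apply: cont_big => [g k|a]; first exact: contD.
exact: cont_nc2.
Qed.

(** The values on decompositions of length [d] form a compact, hence closed, set without 0, so a
    ball around 0 misses it; its radius is [eps]. This also covers an empty set of
    decompositions. *)
Lemma roof_bound (rho : 'M[C]_n) (G : 'cV[C]_n -> R) :
  continuous_on_states G ->
  (forall (p : 'I_d -> R) psi, decomposition p psi rho ->
     0 < \sum_l p l * G (psi l)) ->
  exists2 eps, 0 < eps & forall m (p : 'I_m -> R) psi, decomposition p psi rho ->
     eps <= \sum_l p l * G (psi l).
Proof.
move=> hG pos.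
(* Weights lie in [0, 1] and, for unit vectors, real and imaginary parts in [-1, 1]. *)
pose box (i : 'I_#|{: idx}|) : set R :=
  if (enum_val i).2 is None then `[0, 1]%classic else `[-1, 1]%classic.
pose B : set param := [set x | forall i, box i (x ord0 i)]%classic.
have Bcompact : compact B.
  apply: rV_compact => i; rewrite /box; case: (enum_val i).2 => [_|];
  exact: segment_compact.
(* A sum of squares that vanishes exactly when the equations of a decomposition hold; nonnegative
   weights come from [box]. *)
pose defect (x : param) : R :=
  (\sum_l weight x l - 1) ^+ 2 + (\sum_l (nrm2 (vect x l) - 1) ^+ 2 +
  \sum_a \sum_b nc (\sum_l (weight x l)%:C * (vect x l a 0 * ((vect x l b 0)^*)%R)
                     - rho a b) ^+ 2).
have wcont l : continuous (weight ^~ l) by exact: coord_cont.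
have dcont : continuous defect.
  apply: contD.
    apply: contM; apply: contD; try exact: cont_const;
    by apply: cont_big => [f g|l]; [exact: contD | exact: wcont].
  apply: contD.
    apply: cont_big => [f g|l]; first exact: contD.
    by apply: contM; apply: contD; try exact: cont_const; apply: nrm2_continuous.
  apply: cont_big => [f g|a]; first exact: contD.
  apply: cont_big => [f g|b]; first exact: contD.
  apply: cont_nc2; apply: ccontD; last exact: ccont_const.
  apply: ccont_sum => l; apply: ccontM; first exact: ccont_real.
  by apply: ccontM; last exact: ccontJ.
pose K := (B `&` [set x | defect x = 0])%classic.
have Kcompact : compact K.
  apply: compact_closedI => //.
  have -> : [set x | defect x = 0]%classic = (defect @^-1` [set 0])%classic by [].
  by apply: preimage_closed => // x _; exact: dcont.
have Kdec x : K x -> decomposition (weight x) (vect x) rho.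
  move=> [Bx /eqP]; rewrite /defect.
  have s1 l : 0 <= (nrm2 (vect x l) - 1) ^+ 2 by exact: sqr_ge0.
  have s2 a b : 0 <= nc (\sum_l (weight x l)%:C * (vect x l a 0 * ((vect x l b 0)^*)%R)
                     - rho a b) ^+ 2 by exact: sqr_ge0.
  have s3 a : 0 <= \sum_b nc (\sum_l (weight x l)%:C *
      (vect x l a 0 * ((vect x l b 0)^*)%R) - rho a b) ^+ 2.
    by apply: sumr_ge0 => b _.
  rewrite paddr_eq0 ?sqr_ge0 //; last first.
    by rewrite addr_ge0 //; apply: sumr_ge0 => ? _.
  rewrite sqrf_eq0 subr_eq0 => /andP[/eqP w1].
  rewrite paddr_eq0; try by apply: sumr_ge0 => ? _.
  rewrite !psumr_eq0 // => /andP[/allP u1 /allP e1].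
  split=> //.
  - move=> l; have := Bx (enum_rank (l, None)); rewrite /box enum_rankK /=.
    by rewrite in_itv /= => /andP[].
  - move=> l; apply/unit_nrm2; apply/eqP.
    by have := u1 l (mem_index_enum _); rewrite /= sqrf_eq0 subr_eq0.
  apply/matrixP => a b; have := e1 a (mem_index_enum _); rewrite /= psumr_eq0 //.
  move=> /allP /(_ b (mem_index_enum _)) /=; rewrite sqrf_eq0 => /eqP /nc_eq0 /eqP.
  rewrite subr_eq0 => /eqP <-; rewrite summxE; apply: eq_bigr => l _.
  by rewrite [RHS]mxE proj_ofE.
have decK (p : 'I_d -> R) psi : decomposition p psi rho -> exists2 x, K x &
    (forall l, weight x l = p l) /\ (forall l, vect x l = psi l).
  move=> [p0 p1 u e].
  pose x : param := \row_i match enum_val i with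
    | (l, None) => p l
    | (l, Some (a, true)) => complex.Re (psi l a 0)
    | (l, Some (a, false)) => complex.Im (psi l a 0) end.
  have wx l : weight x l = p l by rewrite /weight /coord mxE enum_rankK.
  have vx l : vect x l = psi l.
    apply/matrixP => a b; rewrite ord1 mxE /coord !mxE !enum_rankK.
    by case: (psi l a 0).
  exists x; last by [].
  split.
    move=> i; rewrite /box /x mxE; case: (enum_val i) => l [[a c]|] /=.
      have := iffLR (unit_nrm2 _) (u l); rewrite /nrm2 (bigD1 a) //= nc_sqrE.
      have : 0 <= \sum_(i < n | i != a) nc (psi l i 0) ^+ 2.
        by apply: sumr_ge0 => ? _; exact: sqr_ge0.
      by case: c => h1 h2; rewrite in_itv /=; apply/andP; split; nra.
    rewrite in_itv /= p0 /= -p1 (bigD1 l) //= lerDl.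
    by apply: sumr_ge0 => ? _; exact: p0.
  rewrite /= /defect; under eq_bigr do rewrite wx.
  rewrite p1 subrr expr0n add0r big1 => [|l _]; last first.
    by rewrite vx (iffLR (unit_nrm2 _) (u l)) subrr expr0n.
  rewrite add0r big1 // => a _; rewrite big1 // => b _.
  rewrite e summxE -sumrB big1 ?nc0 ?expr0n // => l _.
  by rewrite wx vx [X in _ - X]mxE proj_ofE subrr.
pose g (x : param) := \sum_l weight x l * G (vect x l).
have gcont : continuous g.
  apply: cont_big => [f1 f2|l]; first exact: contD.
  by apply: contM; [exact: wcont | apply: hG].
have gK : compact (g @` K)%classic.
  by apply: continuous_compact => //; apply: continuous_subspaceT.
have gclosed := compact_closed (@norm_hausdorff _ R) gK.
have n0 : ~ (g @` K)%classic 0.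
  by move=> [x Kx g0]; have := pos _ _ (Kdec x Kx); rewrite -/(g x) g0 ltxx.
have : nbhs (0 : R) (~` (g @` K))%classic by apply: open_nbhs_nbhs; split=> //; exact: closed_openC.
move=> /nbhs_ballP[eps /= eps0 heps]; exists eps => // m p psi dec.
have [p1 [psi1 [dec1 v1]]] := decomposition_caratheodory G dec.
apply: le_trans v1; have [x Kx [wx vx]] := decK _ _ dec1.
have -> : \sum_l p1 l * G (psi1 l) = g x.
  by apply: eq_bigr => l _; rewrite wx vx.
rewrite leNgt; apply/negP => lt; apply: (heps (g x)); last by exists x.
rewrite /ball /= sub0r normrN ger0_norm //.
by rewrite ltW //; exact: (pos _ _ (Kdec x Kx)).
Qed.

End RoofBound.

(** * The four measures *)

Section Aggregation.
Variable R : realType.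
Implicit Types t : 'I_4 -> 'I_4 -> R.

Definition pair_prod t : R := \prod_(ij : 'I_4 * 'I_4 | (ij.1 < ij.2)%N) t ij.1 ij.2.

Lemma pair_prod_ge0 t : (forall i j : 'I_4, (i < j)%N -> 0 <= t i j) -> 0 <= pair_prod t.
Proof. by move=> h; apply: prodr_ge0 => -[i j] /h. Qed.

Lemma pair_prod_le t (i0 j0 : 'I_4) : (i0 < j0)%N ->
  (forall i j : 'I_4, (i < j)%N -> 0 <= t i j <= 1) -> pair_prod t <= t i0 j0.
Proof.
move=> lt0 h; rewrite /pair_prod (bigD1 (i0, j0)) //=.
have /andP[t0 _] := h _ _ lt0; rewrite -[leRHS]mulr1 ler_wpM2l //.
by apply: Num.Theory.prodr_ile1 => -[i j] /andP[/h].
Qed.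

Lemma pair_prod_le1 t : (forall i j : 'I_4, (i < j)%N -> 0 <= t i j <= 1) -> pair_prod t <= 1.
Proof. by move=> h; apply: Num.Theory.prodr_ile1 => -[i j] /h. Qed.

Lemma min_pairs_ge t c : (forall i j : 'I_4, (i < j)%N -> c <= t i j) -> c <= min_pairs t.
Proof.
by move=> h; apply: le_bigmin => [|[i j]]; exact: h.
Qed.

Lemma min_pairs_le t (i j : 'I_4) : (i < j)%N -> min_pairs t <= t i j.
Proof.
move=> h; exact: (@bigmin_le_cond _ _ _ _ (i, j)
  (fun ij : 'I_4 * 'I_4 => (ij.1 < ij.2)%N) (fun ij => t ij.1 ij.2) h).
Qed.

(** On [0, 1] a number is at most its sixth root. *)
Lemma gm_pairs_ge t : (forall i j : 'I_4, (i < j)%N -> 0 <= t i j <= 1) ->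
  pair_prod t <= gm_pairs t.
Proof.
move=> h; have h0 : 0 <= pair_prod t by apply: pair_prod_ge0 => i j /h /andP[].
have [e0|n0] := eqVneq (pair_prod t) 0; first by rewrite e0 powR_ge0.
apply: ger1_powR; last by rewrite invf_le1 ?ler1n // ltr0n.
by rewrite lt_def n0 h0 pair_prod_le1.
Qed.

Lemma gm_pairs_eq0 t (i j : 'I_4) : (i < j)%N -> t i j = 0 -> gm_pairs t = 0.
Proof.
move=> lij z; rewrite /gm_pairs (bigD1 (i, j)) //= z mul0r powR0 //.
by rewrite invr_eq0 pnatr_eq0.
Qed.

End Aggregation.

(** * A polynomial lower bound for the pure-state quantities *)

Section Witness.
Variable R : realType.
Local Notation C := R[i].
Local Notation state := 'cV[C]_(dimq 'I_4).
Local Notation probes := {ffun 'I_4 -> 'I_3}.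

(* Every party gets a probe, although those of i and j are irrelevant: this
   avoids naming the other two parties. *)
Definition probe_form (i j : 'I_4) (psi : state) : R :=
  (#|{: probes}|%:R)^-1 *
  \sum_(c : probes) nc (\det (contr i j (fun u => probe R (c u) ord0) psi)) ^+ 2.

(** Squared moduli make it polynomial in real and imaginary parts; averaging over probes keeps each
    factor below its pair quantity, and a product of numbers in [0, 1] is below their minimum and
    geometric mean. *)
Definition witness (psi : state) : R := pair_prod (fun i j => probe_form i j psi).

Let card_gt0 : 0 < (#|{: probes}|%:R : R).
Proof. by rewrite ltr0n; apply/card_gt0P; exists [ffun=> ord0]. Qed.

Lemma probe_form_ge0 i j psi : 0 <= probe_form i j psi.
Proof.
by rewrite mulr_ge0 ?invr_ge0 ?ler0n //; apply: sumr_ge0 => c _; exact: sqr_ge0.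
Qed.

Lemma witness_ge0 psi : 0 <= witness psi.
Proof. by apply: pair_prod_ge0 => i j _; exact: probe_form_ge0. Qed.

Lemma witness_continuous : continuous_on_states witness.
Proof.
move=> X f hf; apply: cont_big => [g h|[i j] /=]; first exact: contM.
apply: contM; first exact: cont_const.
apply: cont_big => [g h|c]; first exact: contD.
have ccN (h : X -> C) : ccont h -> ccont (fun x => - h x).
  move=> hh; have -> : (fun x => - h x) = (fun x => (-1) * h x).
    by apply: funext => x; rewrite mulN1r.
  by apply: ccontM => //; exact: ccont_const.
have ent x y : ccont (fun z => contr i j (fun u => probe R (c u) ord0) (f z) x y).
  have -> : (fun z => contr i j (fun u => probe R (c u) ord0) (f z) x y) =
     (fun z => \sum_(w : ket 'I_4 | (w i == x) && (w j == y))
        (\prod_(u | u \notin [set i; j]%SET) probe R (c u) ord0 (w u)) * f z (kidx w) 0).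
    by apply: funext => z; rewrite mxE.
  by apply: ccont_sum => w; apply: ccontM; [exact: ccont_const | exact: hf].
apply: cont_nc2.
have -> : (fun x => \det (contr i j (fun u => probe R (c u) ord0) (f x))) = (fun x =>
    let m := contr i j (fun u => probe R (c u) ord0) (f x) in
    m ord0 ord0 * m ord_max ord_max + - (m ord0 ord_max * m ord_max ord0)).
  by apply: funext => x; rewrite det2.
by apply: ccontD; [apply: ccontM | apply: ccN; apply: ccontM]; exact: ent.
Qed.

(** One vanishing factor suffices: for its pair all probe determinants vanish, hence by [probes_det]
    those of all contractions. *)
Lemma witness_eq0 psi : witness psi = 0 -> biseparable_pure psi.
Proof.
move/eqP; rewrite /witness /pair_prod => /prodf_eq0[[i j] /= lij /eqP].
move/eqP; rewrite mulf_eq0 invr_eq0 (gt_eqF card_gt0) /= => /eqP z.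
have {}z (c : probes) : \det (contr i j (fun u => probe R (c u) ord0) psi) = 0.
  apply: nc_eq0; apply/eqP; rewrite -sqrf_eq0; apply/eqP.
  apply: (@psumr_eq0P _ _ xpredT
    (fun c : probes => nc (\det (contr i j (fun u => probe R (c u) ord0) psi)) ^+ 2)) => //.
  by move=> c' _; exact: sqr_ge0.
have ij : i != j by rewrite -val_eqE ltn_eqF.
have [k [l [ijkl cover]]] := ord4_complete ij.
apply: (biseparable_of_det ijkl cover) => a.
have lk : l == k = false.
  rewrite eq_sym; move: ijkl; rewrite /= !inE !negb_or.
  by move=> /and4P[_ _ /negbTE].
pose W x y u v := psi (kidx (ket4 i j k x y u v)) 0.
have E b : contr i j b psi = \matrix_(x, y) \sum_u \sum_v b k u * b l v * W x y u v.
  by apply/matrixP => x y; rewrite (contr4 ijkl cover) mxE.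
rewrite E; apply: (@probes_det _ W) => p q.
have := z [ffun u => if u == k then p else q].
by rewrite E !ffunE eqxx lk.
Qed.

(* "gem" stands for genuine multipartite entanglement measure. *)
Definition gem_seed (E : state -> R) := forall psi, unit_vector psi ->
  [/\ witness psi <= E psi,
      (biseparable_pure psi -> E psi <= 0) &
      forall V : 'I_4 -> 'M[C]_2, (forall u, V u \is unitarymx) ->
        E (tens_op V *m psi) = E psi].

Lemma pair_measure_bounds t : pair_measure t -> forall psi, unit_vector psi ->
  [/\ forall i j : 'I_4, (i < j)%N -> 0 <= t i j psi <= 1,
      witness psi <= pair_prod (fun i j => t i j psi) &
      biseparable_pure psi -> exists i j : 'I_4, (i < j)%N /\ t i j psi = 0].
Proof.
move=> pm psi hpsi.
have ne (i j : 'I_4) : (i < j)%N -> i != j by move=> h; rewrite -val_eqE ltn_eqF.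
have t01 (i j : 'I_4) : (i < j)%N -> 0 <= t i j psi <= 1.
  by move=> /ne ij; case: (pm i j ij psi hpsi).
split=> //.
  apply: ler_prod => -[i j] /= lij; rewrite probe_form_ge0 /=.
  rewrite /probe_form ler_pdivrMl // mulr_natl -sumr_const.
  apply: ler_sum => c _; have /andP[_ t1] := t01 i j lij.
  have [_ /(_ c) h _ _] := pm i j (ne _ _ lij) psi hpsi.
  (* With n the modulus of the determinant, 2n <= t <= 1 gives n^2 <= t. *)
  by have := nc_ge0 (\det (contr i j (fun u => probe R (c u) ord0) psi)); nra.
move=> /biseparable_pureP[A [A0 AT fA]].
have [i iA] := finset.set0Pn _ A0.
have [j jA] : exists j, j \notin A.
  have : ~: A != finset.set0 by apply: contraNneq AT => h; rewrite -(finset.setCK A) h finset.setC0.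
  by move=> /finset.set0Pn[j]; rewrite inE; exists j.
have zero (s r : 'I_4) : (s < r)%N -> (s \in A) != (r \in A) -> t s r psi = 0.
  move=> lsr sr; apply/eqP; rewrite eq_le; have /andP[-> _] := t01 s r lsr.
  rewrite andbT; have [_ _ h _] := pm s r (ne _ _ lsr) psi hpsi; apply: h => a.
  exact: det_contr_biseparable sr fA.
have [lij|lji|ij] := ltngtP i j.
- by exists i, j; split=> //; apply: zero; rewrite // iA (negbTE jA).
- by exists j, i; split=> //; apply: zero; rewrite // iA (negbTE jA).
- by move: jA; rewrite -(val_inj ij) iA.
Qed.

Lemma min_seed t : pair_measure t -> gem_seed (fun psi => min_pairs (fun i j => t i j psi)).
Proof.
move=> pm psi hpsi; have [t01 wt bis] := pair_measure_bounds pm hpsi; split.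
- apply: (le_trans wt); apply: min_pairs_ge => i j lij.
  exact: (@pair_prod_le _ (fun i j => t i j psi)).
- move=> /bis[i [j [lij <-]]]; exact: (@min_pairs_le _ (fun i j => t i j psi)).
move=> V hV; have tV (i j : 'I_4) : (i < j)%N -> t i j (tens_op V *m psi) = t i j psi.
  by move=> lij; have ij : i != j; [rewrite -val_eqE ltn_eqF | case: (pm i j ij psi hpsi) => _ _ _; apply].
rewrite /min_pairs tV //; apply: eq_bigr => -[i j] lij; exact: tV.
Qed.

Lemma gm_seed t : pair_measure t -> gem_seed (fun psi => gm_pairs (fun i j => t i j psi)).
Proof.
move=> pm psi hpsi; have [t01 wt bis] := pair_measure_bounds pm hpsi; split.
- by apply: (le_trans wt); exact: (@gm_pairs_ge _ (fun i j => t i j psi)).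
- move=> /bis[i [j [lij z]]]; by rewrite (@gm_pairs_eq0 _ (fun i j => t i j psi) i j).
move=> V hV; have tV (i j : 'I_4) : (i < j)%N -> t i j (tens_op V *m psi) = t i j psi.
  by move=> lij; have ij : i != j; [rewrite -val_eqE ltn_eqF | case: (pm i j ij psi hpsi) => _ _ _; apply].
rewrite /gm_pairs; congr powR; apply: eq_bigr => -[i j] lij; exact: tV.
Qed.

End Witness.

Section ConvexRoof.
Variables (R : realType) (E : 'cV[R[i]]_(dimq 'I_4) -> R).
Hypothesis seed : gem_seed E.
Local Notation C := R[i].

Let values rho := [set v | exists m (p : 'I_m -> R) (psi : 'I_m -> 'cV[C]_(dimq 'I_4)),
         decomposition p psi rho /\ v = \sum_(l < m) p l * E (psi l)]%classic.

(** Bounds the set below, so that [inf] is a genuine infimum. *)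
Let value_ge0 rho v : values rho v -> 0 <= v.
Proof.
move=> [m [p [psi [[p0 p1 u e] ->]]]]; apply: sumr_ge0 => l _.
have [h _ _] := seed (u l); rewrite mulr_ge0 //; exact: le_trans (witness_ge0 _) h.
Qed.

Let roof_le rho v : values rho v -> convex_roof E rho <= v.
Proof. by move=> hv; apply: ge_inf => //; exists 0 => w; exact: value_ge0. Qed.

Let values_neq0 rho : density rho -> (values rho !=set0)%classic.
Proof.
move=> /density_decomposition[p [psi h]].
by exists (\sum_l p l * E (psi l)); exists (dimq 'I_4), p, psi.
Qed.

Lemma roof_biseparable rho : biseparable rho -> convex_roof E rho <= 0.
Proof.
move=> [m [p [psi [dec bis]]]].
have : values rho (\sum_l p l * E (psi l)) by exists m, p, psi.
move=> /roof_le h; apply: (le_trans h); case: dec => p0 _ u _.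
apply: sumr_le0 => l _; have [_ e _] := seed (u l).
by rewrite mulr_ge0_le0 // e.
Qed.

Lemma roof_gt0 rho : density rho -> ~ biseparable rho -> 0 < convex_roof E rho.
Proof.
move=> hrho nbis.
have [|eps eps0 heps] := @roof_bound R _ rho _ (@witness_continuous R).
  move=> p psi dec; rewrite lt_def; apply/andP; split; last first.
    by case: dec => p0 _ _ _; apply: sumr_ge0 => l _; rewrite mulr_ge0 ?witness_ge0.
  apply/eqP => z; apply: nbis; have [p0 p1 u e] := dec.
  have bis l : p l != 0 -> biseparable_pure (psi l).
    move=> pl; apply: witness_eq0.
    have /eqP : p l * witness (psi l) = 0.
      apply: (@psumr_eq0P _ _ xpredT (fun l => p l * witness (psi l))) => // l' _.
      by rewrite mulr_ge0 ?witness_ge0.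
    by rewrite mulf_eq0 (negbTE pl) => /eqP.
  have [l1 pl1] : exists l, p l != 0.
    apply: contrapT => h; have : (1 : R) = 0; last by apply/eqP; rewrite oner_eq0.
    rewrite -p1 big1 // => l _; apply/eqP; apply: contrapT => /negP hl.
    by apply: h; exists l.
  (* A vector of weight 0 need not be biseparable; it is replaced by one of nonzero weight. *)
  exists _, p, (fun l => if p l == 0 then psi l1 else psi l); split; last first.
    by move=> l; case: eqP => [_|/eqP]; exact: bis.
  split=> //; first by move=> l; case: ifP.
  by rewrite e; apply: eq_bigr => l _; case: eqP => // ->; rewrite !scale0r.
apply: (lt_le_trans eps0); apply: lb_le_inf; first exact: values_neq0.
move=> _ [m [p [psi [dec ->]]]]; apply: le_trans (heps _ _ _ dec) _.
case: dec => p0 _ u _; apply: ler_sum => l _; apply: ler_wpM2l => //.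
by case: (seed (u l)).
Qed.

Let values_tens rho (V : 'I_4 -> 'M[C]_2) v : (forall k, V k \is unitarymx) ->
  values rho v -> values (tens_op V *m rho *m (tens_op V)^t*) v.
Proof.
move=> hV [m [p [psi [[p0 p1 u e] ->]]]].
exists m, p, (fun l => tens_op V *m psi l); split; last first.
  by apply: eq_bigr => l _; have [_ _ ->] := seed (u l).
split=> //.
  move=> l; apply/unit_nrm2; rewrite nrm2_isometry ?(iffLR (unit_nrm2 _) (u l)) //.
  by apply: mulmx1C; apply/unitarymxP; exact: tens_op_unitary.
rewrite e mulmx_sumr mulmx_suml; apply: eq_bigr => l _.
by rewrite -scalemxAr -scalemxAl proj_of_mul.
Qed.

(** [values_tens] gives one inclusion of value sets; applied to the adjoint unitaries it gives the
    other. *)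
Lemma roof_tens rho (V : 'I_4 -> 'M[C]_2) : (forall k, V k \is unitarymx) ->
  convex_roof E (tens_op V *m rho *m (tens_op V)^t*) = convex_roof E rho.
Proof.
move=> hV; rewrite /convex_roof; apply: f_equal; apply/seteqP; split=> v hv; last exact: values_tens.
have hV' k : (V k)^t* \is unitarymx by rewrite trmxC_unitary.
have := values_tens hV' hv; rewrite -tens_op_adj trmxCK.
have VV : (tens_op V)^t* *m tens_op V = 1%:M.
  by apply: mulmx1C; apply/unitarymxP; exact: tens_op_unitary.
by rewrite !mulmxA VV mul1mx -mulmxA VV mulmx1.
Qed.

(** Concatenating decompositions of [rho] and [sigma], with rescaled weights, decomposes the
    mixture. *)
Lemma roof_convex rho sigma (p : R) : density rho -> density sigma -> 0 <= p <= 1 ->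
  convex_roof E (p%:C *: rho + (1 - p)%:C *: sigma) <=
  p * convex_roof E rho + (1 - p) * convex_roof E sigma.
Proof.
move=> hrho hsigma /andP[p0 p1].
have q0 : 0 <= 1 - p by rewrite subr_ge0.
have mix v w : values rho v -> values sigma w ->
    values (p%:C *: rho + (1 - p)%:C *: sigma) (p * v + (1 - p) * w).
  move=> [m1 [p1' [psi1 [[a1 b1 c1 d1] ->]]]] [m2 [p2' [psi2 [[a2 b2 c2 d2] ->]]]].
  exists (m1 + m2)%N.
  exists (fun l => match split l with inl l => p * p1' l | inr l => (1 - p) * p2' l end).
  exists (fun l => match split l with inl l => psi1 l | inr l => psi2 l end).
  have sl l : split (lshift m2 l) = inl l by exact: (unsplitK (inl l)).
  have sr l : split (rshift m1 l) = inr l by exact: (unsplitK (inr l)).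
  split; last first.
    rewrite big_split_ord /= !mulr_sumr; congr (_ + _); apply: eq_bigr => l _.
      by rewrite sl mulrA.
    by rewrite sr mulrA.
  split.
  - by move=> l; case: split => l'; rewrite mulr_ge0.
  - rewrite big_split_ord /=; under eq_bigr do rewrite sl.
    under [X in _ + X]eq_bigr do rewrite sr.
    by rewrite -!mulr_sumr b1 b2; ring.
  - by move=> l; case: split.
  rewrite big_split_ord /= d1 d2 !scaler_sumr; congr (_ + _); apply: eq_bigr => l _.
    by rewrite sl rmorphM scalerA.
  by rewrite sr rmorphM scalerA.
have inf1 : has_inf (values rho).
  by split; [exact: values_neq0 | exists 0 => w; exact: value_ge0].
have inf2 : has_inf (values sigma).
  by split; [exact: values_neq0 | exists 0 => w; exact: value_ge0].
(* Decompositions within [eps] of the two infima stand in for optimal ones. *)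
apply/ler_addgt0Pr => eps eps0.
have [v hv lv] := inf_adherent eps0 inf1; have [w hw lw] := inf_adherent eps0 inf2.
apply: (le_trans (roof_le (mix _ _ hv hw))).
have -> : p * convex_roof E rho + (1 - p) * convex_roof E sigma + eps =
  p * (convex_roof E rho + eps) + (1 - p) * (convex_roof E sigma + eps) by ring.
by apply: lerD; apply: ler_wpM2l => //; apply: ltW.
Qed.

End ConvexRoof.

Theorem corollary10 (R : realType) (E : 'M[R[i]]_(dimq 'I_4) -> R)
    (hE : [\/ E = @Tmin4 R, E = @TGM4 R, E = @Tbarmin4 R | E = @TbarGM4 R]) :
  [/\ (forall rho : 'M[R[i]]_(dimq 'I_4), density rho ->
         (0 < E rho <-> ~ biseparable rho)),
      (forall (rho : 'M[R[i]]_(dimq 'I_4)) (U : 'I_4 -> 'M[R[i]]_2),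
         density rho -> (forall k, U k \is unitarymx) ->
         E (tens_op U *m rho *m (tens_op U) ^t*) = E rho)
    & (forall (rho sigma : 'M[R[i]]_(dimq 'I_4)) (p : R),
         density rho -> density sigma -> 0 <= p <= 1 ->
         E (p%:C *: rho + (1 - p)%:C *: sigma) <=
           p * E rho + (1 - p) * E sigma)].
Proof.
have [E0 seed ->] : exists2 E0, gem_seed E0 & E = convex_roof E0.
  case: hE => ->; eexists; try reflexivity.
  - exact: min_seed (@T4_pair_measure R).
  - exact: gm_seed (@T4_pair_measure R).
  - exact: min_seed (@Tbar4_pair_measure R).
  - exact: gm_seed (@Tbar4_pair_measure R).
split=> [rho hrho|rho U _ hU|rho sigma p].
- split=> [h /(roof_biseparable seed)|]; first by rewrite leNgt h.
  exact: roof_gt0.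
- exact: roof_tens.
- exact: roof_convex.
Qed.
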